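(* Let $V$ be a superquadratic Orlicz function, and for $n\in\mathbb N$ let $X^{(n)}$ be uniformly distributed on the Orlicz ball $\mathbb B_V^n=\{x\in\mathbb R^n:\sum_{i=1}^nV(x_i)\le n\}$. Then $\{\|X^{(n)}\|_2/\sqrt n\}_{n\in\mathbb N}$ satisfies an LDP at speed $n$ with GRF $$J_{X,V}(z)=\mathcal J(1,z^2)-\sup_{s<0}\left\{s-\log\left(\int_{D_V}e^{sV(x)}dx\right)\right\},\qquad z\in\mathbb R_+=[0,\infty).$$ Moreover, there exists a unique $b^*>0$ such that $M_V(\mu_{V,b^*})=1$, and $J_{X,V}$ has a unique minimizer $m:=\sqrt{M_2(\mu_{V,b^*})}$.
   Context: An Orlicz function is a convex function $V:\mathbb R\to\mathbb R_+\cup\{\infty\}$ with $V(0)=0$ and $V(x)=V(-x)$ for $x\in\mathbb R$; its domain is $D_V=\{x\in\mathbb R:V(x)<\infty\}$. $V$ is superquadratic if $V(x)/x^2\to\infty$ as $x\to\infty$. For $u,v\in\mathbb R_+$, $\mathcal J(u,v)=\sup_{s<0,\,t\in\mathbb R}\left\{su+tv-\log\left(\int_{D_V}e^{sV(x)+tx^2}dx\right)\right\}$. For $b>0$, $\mu_{V,b}$ is the probability measure on $D_V$ with density $e^{-bV(x)}/\int_{D_V}e^{-bV(y)}dy$. $M_V(\nu)=\int V\,d\nu$ and $M_2(\nu)=\int x^2\,\nu(dx)$. LDP: a sequence of random variables $\{\eta_n\}$ with values in a regular topological space $\mathcal X$ satisfies a large deviation principle (LDP) at speed $s_n$ with rate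 function $I:\mathcal X\to[0,\infty]$ if $I$ is lower semicontinuous and for every Borel set $\Gamma$, $-\inf_{\Gamma^\circ}I\le\liminf_n\frac1{s_n}\log\mathbb P(\eta_n\in\Gamma)\le\limsup_n\frac1{s_n}\log\mathbb P(\eta_n\in\Gamma)\le-\inf_{\bar\Gamma}I$. It is a good rate function (GRF) if moreover its level sets are compact.
   Formalization: The ''moreover'' part is proved under the condition that the integral of V−1 over D_V is positive, which is necessary and sufficient for b* to exist; it fails e.g. for V=0 on [-1,1], V=∞ elsewhere. The LDP and GRF claims are unconditional. *)

(* Defs.v *)
From HB Require Import structures.
From mathcomp Require Import all_boot all_order all_algebra.
From mathcomp Require Import all_classical all_reals all_analysis.

Set Implicit Arguments.
Unset Strict Implicit.
Unset Printing Implicit Defensive.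
Import Order.TTheory GRing.Theory Num.Theory.
Import numFieldNormedType.Exports.

Local Open Scope classical_set_scope.
Local Open Scope ring_scope.
Local Open Scope ereal_scope.

Definition borel (X : topologicalType) : set (set X) :=
  <<s [set U : set X | open U] >>.

Definition rate_function (R : realType) (X : topologicalType)
    (I : X -> \bar R) : Prop :=
  (forall x, 0 <= I x) /\ lower_semicontinuous I.

Definition good_rate_function (R : realType) (X : topologicalType)
    (I : X -> \bar R) : Prop :=
  rate_function I /\ forall a : R, compact [set x | I x <= a%:E].

(* The variables [eta n] may live on different probability spaces.
   [lne] is the extended logarithm, with [lne 0 = -oo]. *)
Definition ldp (R : realType) (d : nat -> measure_display)
    (Omega : forall n, measurableType (d n))
    (P : forall n, probability (Omega n) R) (X : topologicalType)
    (eta : forall n, Omega n -> X) (s : nat -> R) (I : X -> \bar R) : Prop :=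
  let rescaled_log (G : set X) (n : nat) :=
    ((s n)^-1)%:E * lne (P n (eta n @^-1` G)) in
  [/\ rate_function I,
      forall n (G : set X), borel G -> measurable (eta n @^-1` G) &
      forall G : set X, borel G ->
        [/\ - ereal_inf [set I x | x in interior G]
              <= limn_einf (rescaled_log G),
            limn_einf (rescaled_log G) <= limn_esup (rescaled_log G) &
            limn_esup (rescaled_log G)
              <= - ereal_inf [set I x | x in closure G]]].

(* Lebesgue measure on R^n, as the n-fold product of Lebesgue measure on R:
   integrate the measure of the slices along the first coordinate. *)
Fixpoint lebesgue_tuple (R : realType) (n : nat) :
    set (n.-tuple R) -> \bar R :=
  match n with
  | 0 => fun A => \d_([tuple] : 0.-tuple R) A
  | k.+1 => fun A => \int[@lebesgue_measure R]_x
      @lebesgue_tuple R k [set y : k.-tuple R | A [tuple of x :: y]]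
  end.

(* When [B] has volume 0 no [X] satisfies this, since [P setT = 1]. *)
Definition uniform_on (R : realType) (d : measure_display)
    (Omega : measurableType d) (P : probability Omega R) (n : nat)
    (B : set (n.-tuple R)) (X : Omega -> n.-tuple R) : Prop :=
  forall A : set (n.-tuple R), measurable A ->
    P (X @^-1` A) = lebesgue_tuple (A `&` B) / lebesgue_tuple B.

(* In the convexity inequality [0 * +oo = 0], so the cases [t = 0] and [t = 1]
   are trivial, as they should be. *)
Definition orlicz (R : realType) (V : R -> \bar R) : Prop :=
  [/\ forall x, 0 <= V x,
      forall (x y t : R), (0 <= t <= 1)%R ->
        V (t * x + (1 - t) * y)%R <= t%:E * V x + (1 - t)%:E * V y,
      V 0%R = 0 &
      forall x, V x = V (- x)%R].

Definition superquadratic (R : realType) (V : R -> \bar R) : Prop :=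
  V x * ((x ^+ 2)^-1)%:E @[x --> +oo%R] --> +oo.

Definition orlicz_dom (R : realType) (V : R -> \bar R) : set R :=
  [set x | V x < +oo].

Definition orlicz_ball (R : realType) (V : R -> \bar R) (n : nat) :
    set (n.-tuple R) :=
  [set x | \sum_(i < n) V (tnth x i) <= n%:R%:E].
Arguments orlicz_ball [R] V n.

Definition log_partition (R : realType) (V : R -> \bar R) (s t : R) : \bar R :=
  lne (\int[@lebesgue_measure R]_(x in orlicz_dom V)
         expeR (s%:E * V x + (t * x ^+ 2)%:E)).

Definition calJ (R : realType) (V : R -> \bar R) (u v : R) : \bar R :=
  ereal_sup [set (p.1 * u + p.2 * v)%:E - log_partition V p.1 p.2 |
             p in [set p : R * R | (p.1 < 0)%R]].

Definition nonneg_reals (R : realType) : set R := [set x : R | (0 <= x)%R].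
Arguments nonneg_reals R : clear implicits.

(* As a type, a set carries the subspace topology. *)
Definition to_nonneg (R : realType) (x : R) (x0 : (0 <= x)%R) :
    nonneg_reals R :=
  exist (fun y => y \in nonneg_reals R) x (mem_set x0).

Definition nonneg_sqrt (R : realType) (x : R) : nonneg_reals R :=
  to_nonneg (sqrtr_ge0 x).

Definition norm2 (R : realType) (n : nat) (x : n.-tuple R) : R :=
  Num.sqrt (\sum_(i < n) tnth x i ^+ 2)%R.

Lemma norm2_div_sqrt_ge0 (R : realType) (n : nat) (x : n.-tuple R) :
  (0 <= norm2 x / Num.sqrt n%:R)%R.
Proof. by rewrite divr_ge0 ?sqrtr_ge0. Qed.

Definition scaled_norm (R : realType) (n : nat) (x : n.-tuple R) :
    nonneg_reals R :=
  to_nonneg (norm2_div_sqrt_ge0 x).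

Definition rate_JXV (R : realType) (V : R -> \bar R) (z : nonneg_reals R) :
    \bar R :=
  calJ V 1 (\val z ^+ 2)%R
  - ereal_sup [set s%:E - log_partition V s 0 | s in [set s : R | (s < 0)%R]].

Definition gibbs (R : realType) (V : R -> \bar R) (b : R) (A : set R) :
    \bar R :=
  (\int[@lebesgue_measure R]_(x in A `&` orlicz_dom V) expeR ((- b)%:E * V x))
  / (\int[@lebesgue_measure R]_(x in orlicz_dom V) expeR ((- b)%:E * V x)).

Definition moment_V (R : realType) (V : R -> \bar R)
    (nu : set R -> \bar R) : \bar R :=
  \int[nu]_x V x.

Definition moment_2 (R : realType) (nu : set R -> \bar R) : \bar R :=
  \int[nu]_x (x ^+ 2)%:E.

(* The average of [V] over its domain exceeds 1. This holds whenever [V] is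
   finite everywhere, the integral being then +oo. It can only fail when the
   domain is bounded, and it is necessary for some [b > 0] to satisfy
   [moment_V V (gibbs V b) = 1]: the integral of [(V - 1) * exp (- b * (V - 1))]
   over the domain is decreasing in [b], and tends to the integral below as
   [b] tends to 0. For instance [V = 0] on [-1, 1] and [V = +oo] elsewhere is
   a superquadratic Orlicz function for which no such [b] exists. *)
Definition mean_exceeds_one (R : realType) (V : R -> \bar R) : Prop :=
  0 < \int[@lebesgue_measure R]_(x in orlicz_dom V) (V x - 1).

(* Main.v *)
Require Import Defs.
From HB Require Import structures.
From mathcomp Require Import all_boot all_order all_algebra.
From mathcomp Require Import all_classical all_reals all_analysis.
From mathcomp Require Import measurable_realfun.
From mathcomp Require Import ring lra.

(* Write Z(s, t) for the integral of exp(s V + t x^2) over the domain of V.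

   Upper bound: on the ball, exp(s (sum V - n)) >= 1 for s < 0, so an exponential
   Chebyshev inequality bounds the volume of the part of the ball on which
   s + t |x|^2/n - ln Z(s, t) exceeds a given level; closed sets are covered by
   finitely many such half-lines.

   Lower bound: let M bound s u + t v - ln Z(s, t).  At a near-maximiser of this
   function minus a small quadratic penalty, comparison with points at distance l,
   together with Z(s + l) + Z(s - l) <= 2 Z(s) + O(l^2), shows that under the
   exponentially tilted product measure the averages of V and x^2 are exponentially
   concentrated near (u, v); only the lower tail of V may fail, and only when s is
   so close to 0 that it is harmless.  Undoing the tilt bounds the volume from below
   by exp(-n M).  The same argument with x^2 replaced by 0 gives the volume of the
   ball, which avoids a minimax theorem.

   Minimizer: the integral of (V - 1) exp(-b (V - 1)) is continuous and decreasing
   in b and has exactly one zero b*.  The point (-b*, 0) is critical for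
   s + t m^2 - ln Z(s, t), so the tangent inequality for exp gives J(m) = 0, while
   a second zero z of J would give another tangent slope of t |-> Z(-b*, t) at 0. *)

Set Implicit Arguments.
Unset Strict Implicit.
Unset Printing Implicit Defensive.
Import Order.TTheory GRing.Theory Num.Theory.
Import numFieldNormedType.Exports.

Local Open Scope classical_set_scope.
Local Open Scope ring_scope.
Local Open Scope ereal_scope.

(** * Iterated integrals over tuples *)

(** The obstacle in the lower bound is that the supremum over (s, t) need not be attained:
    near-maximisers may run off to infinity, or s may tend to 0, where Z may be infinite. The
    penalty confines them to a region known in advance, at the price of a small error in the
    gradient, and a constraint s <= - kappa keeps Z finite. Step lengths and tolerances then depend
    on that region alone, so neither a maximiser nor a derivative of Z is needed there: all gradient
    information is carried by finite differences of Z, whose remainders are again values of Z.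
    Superquadraticity enters by making Z(s, t) finite for every real t as soon as s < 0. *)

Fixpoint tuple_integral (R : realType) (n : nat) :
    (n.-tuple R -> \bar R) -> \bar R :=
  match n with
  | 0 => fun F => F [tuple]
  | k.+1 => fun F => \int[@lebesgue_measure R]_x
      tuple_integral (fun y : k.-tuple R => F [tuple of x :: y])
  end.

Section tuple_integral_theory.
Context {R : realType}.

Lemma lebesgue_tupleE n (A : set (n.-tuple R)) :
  lebesgue_tuple A = tuple_integral (fun y => (\1_A y)%:E).
Proof.
elim: n A => [|n IH] A; first by rewrite /= diracE indicE.
by rewrite /=; apply: eq_integral => x _; rewrite IH.
Qed.

Lemma eq_tuple_integral n (F G : n.-tuple R -> \bar R) :
  F =1 G -> tuple_integral F = tuple_integral G.
Proof. by move=> /funext ->. Qed.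

Lemma tuple_integral_ge0 n (F : n.-tuple R -> \bar R) :
  (forall y, 0 <= F y) -> 0 <= tuple_integral F.
Proof.
elim: n F => [|n IH] F F0 /=; first exact: F0.
by apply: integral_ge0 => x _; exact: IH.
Qed.

(** The parameter space [T] is arbitrary so that the induction can move the head coordinate into the
    parameter, passing from [T] to [T * R]; Tonelli then integrates it out. *)
Lemma measurable_tuple_integral n d (T : measurableType d)
    (F : (T * n.-tuple R)%type -> \bar R) :
  measurable_fun setT F -> (forall z, 0 <= F z) ->
  measurable_fun setT (fun t => tuple_integral (fun y => F (t, y))).
Proof.
elim: n d T F => [|n IH] d T F mF F0 /=.
  by apply: (measurableT_comp mF); exact: measurable_fun_pair.
apply: (measurable_fun_fubini_tonelli_F (m2 := @lebesgue_measure R)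
  (fun z : T * R => tuple_integral
    (fun y : n.-tuple R => F (z.1, [tuple of z.2 :: y])))).
  apply: (IH _ _ (fun z => F (z.1.1, [tuple of z.1.2 :: z.2]))) => //.
  apply: (measurableT_comp mF); apply: measurable_fun_pair.
    exact: measurableT_comp.
  by apply: measurable_cons => //; exact: measurableT_comp.
by move=> z; exact: tuple_integral_ge0.
Qed.

Lemma measurable_tuple_cons n (F : n.+1.-tuple R -> \bar R) (x : R) :
  measurable_fun setT F ->
  measurable_fun setT (fun y : n.-tuple R => F [tuple of x :: y]).
Proof. by move=> mF; apply: measurableT_comp => //; exact: measurable_cons. Qed.

Lemma measurable_tuple_integral_cons n (F : n.+1.-tuple R -> \bar R) :
  measurable_fun setT F -> (forall z, 0 <= F z) ->
  measurable_fun setT (fun x : R =>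
    tuple_integral (fun y : n.-tuple R => F [tuple of x :: y])).
Proof.
move=> mF F0.
apply: (@measurable_tuple_integral n _ _ (fun z => F [tuple of z.1 :: z.2])) => //.
by apply: measurableT_comp => //; exact: measurable_cons.
Qed.

Lemma le_tuple_integral n (F G : n.-tuple R -> \bar R) :
  measurable_fun setT F -> measurable_fun setT G ->
  (forall y, 0 <= F y) -> (forall y, F y <= G y) ->
  tuple_integral F <= tuple_integral G.
Proof.
elim: n F G => [|n IH] F G mF mG F0 FG /=; first exact: FG.
have G0 y : 0 <= G y := le_trans (F0 y) (FG y).
apply: ge0_le_integral => //.
- by move=> x _; exact: tuple_integral_ge0.
- exact: measurable_tuple_integral_cons.
- exact: measurable_tuple_integral_cons.
by move=> x _; apply: IH => //; exact: measurable_tuple_cons.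
Qed.

Lemma tuple_integralD n (F G : n.-tuple R -> \bar R) :
  measurable_fun setT F -> measurable_fun setT G ->
  (forall y, 0 <= F y) -> (forall y, 0 <= G y) ->
  tuple_integral (fun y => F y + G y) = tuple_integral F + tuple_integral G.
Proof.
elim: n F G => [|n IH] F G mF mG F0 G0 //=.
rewrite -ge0_integralD //.
- by apply: eq_integral => x _; apply: IH => //; exact: measurable_tuple_cons.
- by move=> x _; exact: tuple_integral_ge0.
- exact: measurable_tuple_integral_cons.
- by move=> x _; exact: tuple_integral_ge0.
- exact: measurable_tuple_integral_cons.
Qed.

Lemma tuple_integralZ n (F : n.-tuple R -> \bar R) (k : R) :
  measurable_fun setT F -> (forall y, 0 <= F y) -> (0 <= k)%R ->
  tuple_integral (fun y => k%:E * F y) = k%:E * tuple_integral F.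
Proof.
elim: n F => [|n IH] F mF F0 k0 //=.
rewrite -ge0_integralZl_EFin //.
- by apply: eq_integral => x _; apply: IH => //; exact: measurable_tuple_cons.
- by move=> x _; exact: tuple_integral_ge0.
- exact: measurable_tuple_integral_cons.
Qed.

Lemma measurable_tuple_prod n (g : R -> R) : measurable_fun setT g ->
  measurable_fun setT (fun y : n.-tuple R => \prod_(i < n) g (tnth y i))%R.
Proof.
move=> mg; apply: measurable_prod => i _.
by apply: measurableT_comp => //; exact: measurable_tnth.
Qed.

Lemma tuple_integral_prod n (g : R -> R) (Z : R) : measurable_fun setT g ->
  (forall x, 0 <= g x)%R ->
  \int[@lebesgue_measure R]_x (g x)%:E = Z%:E ->
  tuple_integral (fun y : n.-tuple R => (\prod_(i < n) g (tnth y i))%R%:E)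
  = (Z ^+ n)%:E.
Proof.
move=> mg g0 gZ; elim: n => [|n IH]; first by rewrite /= big_ord0 expr0.
have Z0 : (0 <= Z)%R.
  by rewrite -lee_fin -gZ; apply: integral_ge0 => x _; rewrite lee_fin.
rewrite exprS EFinM -gZ muleC -ge0_integralZl_EFin ?exprn_ge0 //.
- rewrite /=; apply: eq_integral => x _.
  rewrite muleC -IH -tuple_integralZ //.
  + apply: eq_tuple_integral => y; rewrite big_ord_recl tnth0 EFinM.
    by congr (_ * _%:E); apply: eq_bigr => i _; rewrite tnthS.
  + by apply: measurableT_comp => //; exact: measurable_tuple_prod.
  + by move=> y; rewrite lee_fin prodr_ge0.
- by move=> x _; rewrite lee_fin.
- exact/measurable_EFinP.
Qed.

End tuple_integral_theory.

(** * Orlicz functions and the partition function *)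

(** Extending the weight by 0 turns integrals over [orlicz_dom V] into integrals over the line, with
    a real-valued integrand. *)
Definition tilt (R : realType) (V : R -> \bar R) (s t x : R) : R :=
  if V x < +oo then expR (s * fine (V x) + t * x ^+ 2) else 0%R.

(** For s < 0 the integral is finite ([partitionE]), so [fine] loses nothing. *)
Definition partition_fun (R : realType) (V : R -> \bar R) (s t : R) : R :=
  fine (\int[@lebesgue_measure R]_x (tilt V s t x)%:E).

Section orlicz_theory.
Context {R : realType} (V : R -> \bar R).
Hypothesis V_orlicz : orlicz V.
Local Notation mu := (@lebesgue_measure R).

Lemma orlicz_ge0 x : 0 <= V x. Proof. by case: V_orlicz. Qed.

Lemma orlicz_fin x : V x < +oo -> (fine (V x))%:E = V x.
Proof. by move=> Vx; rewrite fineK // ge0_fin_numE // orlicz_ge0. Qed.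

Lemma fine_orlicz_ge0 x : (0 <= fine (V x))%R.
Proof. exact/fine_ge0/orlicz_ge0. Qed.

(** This follows from convexity, and the measurability of [V] rests on it. *)
Lemma orlicz_sublevel_interval (r : R) : is_interval [set x | V x <= r%:E].
Proof.
case: V_orlicz => V0 cvx _ _ x y /= Vx Vy z /andP[xz zy].
have [xy|yx] := ltP x y; last first.
  have -> // : z = x by apply/eqP; rewrite eq_le xz (le_trans zy yx).
pose t := ((y - z) / (y - x))%R.
have yx0 : (0 < y - x)%R by rewrite subr_gt0.
have t01 : (0 <= t <= 1)%R.
  rewrite /t divr_ge0 ?subr_ge0 ?(ltW xy) //= ler_pdivrMr // mul1r.
  by rewrite lerD2l lerN2.
have -> : z = (t * x + (1 - t) * y)%R.
  rewrite /t; field; exact: lt0r_neq0.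
apply: le_trans (cvx _ _ _ t01) _.
case/andP: t01 => t0 t1.
have -> : r%:E = t%:E * r%:E + (1 - t)%:E * r%:E.
  by rewrite -!EFinM -EFinD; congr _%:E; ring.
by apply: leeD; apply: lee_wpmul2l => //; rewrite lee_fin // subr_ge0.
Qed.

Lemma measurable_orlicz : measurable_fun setT V.
Proof.
apply: (measurability _ (ErealGenOInfty.measurableE R)) => _ [_ [r ->] <-].
rewrite setTI (_ : _ @^-1` _ = ~` [set x | V x <= r%:E]).
  by apply: measurableC; apply: is_interval_measurable; exact: orlicz_sublevel_interval.
by apply/seteqP; split => x /=; rewrite in_itv /= andbT ltNge => /negP.
Qed.

Lemma measurable_orlicz_dom : measurable (orlicz_dom V).
Proof.
by rewrite -[orlicz_dom V]setTI; exact: emeasurable_fun_infty_o measurable_orlicz _.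
Qed.

Lemma measurable_fine_orlicz : measurable_fun setT (fine \o V).
Proof. exact: measurableT_comp measurable_orlicz. Qed.

Lemma tilt_ge0 s t x : (0 <= tilt V s t x)%R.
Proof. by rewrite /tilt; case: ifP => // _; exact: expR_ge0. Qed.

Lemma measurable_tilt s t : measurable_fun setT (tilt V s t).
Proof.
apply: measurable_fun_ifT => //.
  by apply: (measurable_fun_bool true); rewrite setTI; exact: measurable_orlicz_dom.
apply: measurableT_comp => //; apply: measurable_funD.
  by apply: measurable_funM => //; exact: measurable_fine_orlicz.
by apply: measurable_funM => //; exact: measurable_funX.
Qed.


Hypothesis V_superquadratic : superquadratic V.

(** Beyond [x0] the ratio V / x^2 is at least [K]; up to [x0] the constant absorbs the left side,
    because V >= 0. *)
Lemma superquadratic_quadratic (K : R) :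
  exists C, forall x, V x < +oo -> (K * x ^+ 2 <= fine (V x) + C)%R.
Proof.
move/cvgeyPge : V_superquadratic => /(_ K) [x0 [x0real x0P]].
exists (`|K| * x0 ^+ 2)%R => x Vx.
wlog x_ge0 : x Vx / (0 <= x)%R => [wlg|].
  have [|/ltW x0'] := leP 0%R x; first exact: wlg.
  rewrite -sqrrN; case: V_orlicz => _ _ _ sym; rewrite sym.
  by apply: wlg; rewrite -?sym // oppr_ge0.
have [x0x|xx0] := ltP x0 x.
  have [->|xn0] := eqVneq x 0%R.
    by rewrite expr0n mulr0 addr_ge0 ?fine_orlicz_ge0 // mulr_ge0 // sqr_ge0.
  have x2 : (0 < x ^+ 2)%R by rewrite exprn_gt0 // lt0r xn0.
  have := x0P _ x0x; rewrite -(orlicz_fin Vx) -EFinM lee_fin ler_pdivlMr // => H.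
  by apply: le_trans H _; rewrite lerDl mulr_ge0 // sqr_ge0.
have H1 : (K * x ^+ 2 <= `|K| * x0 ^+ 2)%R.
  apply: (@le_trans _ _ (`|K| * x ^+ 2)%R).
    by rewrite ler_wpM2r ?sqr_ge0 // ler_norm.
  by rewrite ler_wpM2l // ler_sqr // nnegrE // (le_trans x_ge0).
by apply: le_trans H1 _; rewrite lerDr fine_orlicz_ge0.
Qed.

Lemma integrable_tilt s t : (s < 0)%R ->
  mu.-integrable setT (EFin \o tilt V s t).
Proof.
move=> s0.
(* This multiple of x^2 gives s V + t x^2 <= - x^2 - s C, hence a Gaussian dominates the tilt. *)
have [C HC] := superquadratic_quadratic ((t + 1) / - s).
pose g (x : R) : \bar R := (expR (- s * C))%:E * (gauss_fun x)%:E.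
apply: (@le_integrable _ _ _ mu setT measurableT (EFin \o tilt V s t) g).
- by apply/measurable_EFinP; exact: measurable_tilt.
- move=> x _ /=; rewrite lee_fin ger0_norm ?tilt_ge0 // ger0_norm; last first.
    by rewrite mulr_ge0 ?expR_ge0 // gauss_fun_ge0.
  rewrite /tilt; case: ifP => Vx; last by rewrite mulr_ge0 ?expR_ge0 // gauss_fun_ge0.
  rewrite /gauss_fun -expRD ler_expR.
  have s1 : (0 < - s)%R by rewrite oppr_gt0.
  have := HC x Vx; rewrite mulrAC ler_pdivrMr // => H.
  lra.
- by apply: integrableZl => //; exact: integrableT_gauss.
Qed.

Lemma partitionE s t : (s < 0)%R ->
  \int[mu]_x (tilt V s t x)%:E = (partition_fun V s t)%:E.
Proof.
by move=> s0; rewrite /partition_fun fineK //; exact/integrable_fin_num/integrable_tilt.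
Qed.

Hypothesis V_nontrivial : exists2 a : R, (0 < a)%R & V a < +oo.

Lemma orlicz_small_near0 (r : R) : (0 < r)%R ->
  exists2 a : R, (0 < a)%R & forall x, (`|x| <= a)%R -> V x <= r%:E.
Proof.
move=> r0; case: V_nontrivial => a a0 Va.
set M := fine (V a); have M0 : (0 <= M)%R := fine_orlicz_ge0 a.
(* Convexity between 0 and [a] gives V(x) <= (|x| / a) M; the summand [r] in the denominator ensures
   [l <= 1] and covers M = 0. *)
pose l := (r / (M + r))%R.
have Mr : (0 < M + r)%R by rewrite ltr_wpDl.
have l0 : (0 < l)%R by rewrite divr_gt0.
have l1 : (l <= 1)%R by rewrite ler_pdivrMr // mul1r lerDr.
exists (l * a)%R; first by rewrite mulr_gt0.
move=> x xla; case: V_orlicz => _ cvx V00 sym.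
have -> : V x = V `|x|%R by have [_|_] := ger0P x => //.
pose t := (`|x| / a)%R.
have tl : (t <= l)%R by rewrite /t ler_pdivrMr.
have t01 : (0 <= t <= 1)%R by rewrite divr_ge0 ?(ltW a0) //= (le_trans tl).
have -> : `|x|%R = (t * a + (1 - t) * 0)%R.
  by rewrite /t; field; exact: lt0r_neq0.
apply: le_trans (cvx _ _ _ t01) _.
rewrite V00 mule0 adde0 -(orlicz_fin Va) -EFinM lee_fin -/M.
apply: (@le_trans _ _ (l * M)%R); first exact: ler_wpM2r.
by rewrite /l mulrAC ler_pdivrMr // ler_pM2l // lerDl ltW.
Qed.

Lemma partition_ge_itv s t p q m : (s < 0)%R -> (p < q)%R ->
  (forall x, (p <= x <= q)%R ->
     V x < +oo /\ (m <= s * fine (V x) + t * x ^+ 2)%R) ->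
  ((q - p) * expR m <= partition_fun V s t)%R.
Proof.
move=> s0 pq H; rewrite -lee_fin -partitionE //.
have mA : measurable (`[p, q]%classic : set R) by exact: measurable_itv.
have mt : measurable_fun setT (fun x => (tilt V s t x)%:E).
  by apply/measurable_EFinP; exact: measurable_tilt.
have mE : mu `[p, q]%classic = (q - p)%:E.
  by rewrite lebesgue_measure_itv /= lte_fin pq -EFinD.
have -> : ((q - p) * expR m)%:E = \int[mu]_(x in `[p, q]) (expR m)%:E.
  by rewrite integral_cst // mulrC EFinM -mE.
apply: (@le_trans _ _ (\int[mu]_(x in `[p, q]) (tilt V s t x)%:E)).
  apply: ge0_le_integral => //; first exact: measurable_funTS.
  move=> x /=; rewrite in_itv /= => xpq; have [Vx mx] := H x xpq.
  by rewrite lee_fin /tilt Vx ler_expR.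
apply: ge0_subset_integral => //.
by move=> x _; rewrite lee_fin tilt_ge0.
Qed.

(** One [a] serves both signs of t: V <= 1/2 on [-2a, 2a], and x^2 >= a^2 on [a, 2a] handles t >= 0
    while x^2 <= a^2 on [0, a] handles t < 0. *)
Lemma partition_ge_exp : exists2 a : R, (0 < a)%R & forall s t, (s < 0)%R ->
  (a * expR (s / 2 + t * a ^+ 2) <= partition_fun V s t)%R.
Proof.
have [b b0 Vb] : exists2 b : R, (0 < b)%R & forall x, (`|x| <= b)%R -> V x <= (1 / 2)%:E.
  by apply: orlicz_small_near0; rewrite divr_gt0.
have a0 : (0 < b / 2)%R by rewrite divr_gt0.
have Vs s x : (s < 0)%R -> (`|x| <= b)%R ->
    V x < +oo /\ (s / 2 <= s * fine (V x))%R.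
  move=> s0 xb; have Vx := Vb x xb.
  have Voo : V x < +oo by rewrite (le_lt_trans Vx) // ltry.
  split=> //; move: Vx; rewrite -(orlicz_fin Voo) lee_fin div1r => Vx.
  by apply: ler_wnM2l => //; exact: ltW.
exists (b / 2)%R => // s t s0.
have [t0|t0] := leP 0%R t.
  have -> : (b / 2 * expR (s / 2 + t * (b / 2) ^+ 2) =
      (b - b / 2) * expR (s / 2 + t * (b / 2) ^+ 2))%R by field.
  apply: partition_ge_itv => //; first lra.
  move=> x /andP[x1 x2]; have [||Vx sV] := Vs s x => //.
    by rewrite ger0_norm //; lra.
  split=> //; apply: lerD => //; apply: ler_wpM2l => //.
  by rewrite ler_sqr ?nnegrE //; lra.
rewrite -[X in (X * expR _)%R]subr0; apply: partition_ge_itv => //.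
move=> x /andP[x1 x2]; have [||Vx sV] := Vs s x => //.
  by rewrite ger0_norm //; lra.
split=> //; apply: lerD => //; apply: ler_wnM2l; first exact: ltW.
by rewrite ler_sqr ?nnegrE //; lra.
Qed.

Lemma partition_gt0 s t : (s < 0)%R -> (0 < partition_fun V s t)%R.
Proof.
move=> s0; have [a a0 H] := partition_ge_exp.
by apply: lt_le_trans (H s t s0); rewrite mulr_gt0 ?expR_gt0.
Qed.

Lemma log_partitionE s t : (s < 0)%R ->
  log_partition V s t = (ln (partition_fun V s t))%:E.
Proof.
move=> s0; rewrite /log_partition -lne_EFin ?partition_gt0 //; congr lne.
rewrite -partitionE // integral_mkcond.
apply: eq_integral => x _; rewrite patchE /tilt.
have -> : (x \in orlicz_dom V) = (V x < +oo).
  by apply/idP/idP => [/set_mem //|?]; exact/mem_set.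
by case: ifP => // Vx; rewrite -(orlicz_fin Vx).
Qed.

End orlicz_theory.

(** * Tilted volumes *)

Definition energy (R : realType) (V : R -> \bar R) (n : nat) (y : n.-tuple R) : R :=
  (\sum_(i < n) fine (V (tnth y i)))%R.

Definition sumsq (R : realType) (n : nat) (y : n.-tuple R) : R :=
  (\sum_(i < n) tnth y i ^+ 2)%R.

Definition dom_tuple (R : realType) (V : R -> \bar R) (n : nat) : set (n.-tuple R) :=
  [set y | forall i, V (tnth y i) < +oo].
Arguments dom_tuple [R] V n.

(** The unnormalised mass of [A] under the tilted product measure; at s = t = 0 it is the volume of
    the part of [A] in the domain. *)
Definition tilted_volume (R : realType) (V : R -> \bar R) (n : nat) (s t : R)
    (A : set (n.-tuple R)) : \bar R :=
  tuple_integral (fun y : n.-tuple R =>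
    ((\prod_(i < n) tilt V s t (tnth y i)) * \1_A y)%R%:E).

Section measurable_tuple_sets.
Context {R : realType} (n : nat).

Lemma measurable_le_cst (f : n.-tuple R -> R) r : measurable_fun setT f ->
  measurable [set y | (f y <= r)%R].
Proof.
move=> mf; rewrite (_ : [set _ | _] = f @^-1` `]-oo, r]%classic).
  by rewrite -[_ @^-1` _]setTI; apply: mf => //; exact: measurable_itv.
by apply/seteqP; split => y /=; rewrite in_itv.
Qed.

Lemma measurable_ge_cst (f : n.-tuple R -> R) r : measurable_fun setT f ->
  measurable [set y | (r <= f y)%R].
Proof.
move=> mf; rewrite (_ : [set _ | _] = f @^-1` `[r, +oo[%classic).
  by rewrite -[_ @^-1` _]setTI; apply: mf => //; exact: measurable_itv.
by apply/seteqP; split => y /=; rewrite in_itv /= andbT.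
Qed.

End measurable_tuple_sets.

Section tilted_volume_theory.
Context {R : realType} (V : R -> \bar R) (n : nat).
Hypothesis V_orlicz : orlicz V.
Local Notation mu := (@lebesgue_measure R).
Implicit Types (A B : set (n.-tuple R)) (y : n.-tuple R).

Lemma prod_tiltE y s t : dom_tuple V n y ->
  (\prod_(i < n) tilt V s t (tnth y i) = expR (s * energy V y + t * sumsq y))%R.
Proof.
move=> Dy; rewrite /energy /sumsq !mulr_sumr -big_split /= expR_sum.
by apply: eq_bigr => i _; rewrite /tilt Dy.
Qed.

Lemma prod_tilt_out y s t : ~ dom_tuple V n y ->
  (\prod_(i < n) tilt V s t (tnth y i) = 0)%R.
Proof.
move=> /existsNP[i /negP Vi]; rewrite (bigD1 i) //= /tilt (negbTE Vi).
by rewrite mul0r.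
Qed.

Lemma prod_tilt_ge0 y s t : (0 <= \prod_(i < n) tilt V s t (tnth y i))%R.
Proof. by apply: prodr_ge0 => i _; exact: tilt_ge0. Qed.

Lemma measurable_tilted s t A : measurable A ->
  measurable_fun setT (fun y : n.-tuple R =>
    ((\prod_(i < n) tilt V s t (tnth y i)) * \1_A y)%R%:E).
Proof.
move=> mA; apply: measurableT_comp => //; apply: measurable_funM.
  by apply: measurable_tuple_prod; exact: measurable_tilt.
exact: measurable_indic.
Qed.

Lemma tilted_ge0 s t A y :
  0 <= ((\prod_(i < n) tilt V s t (tnth y i)) * \1_A y)%R%:E.
Proof. by rewrite lee_fin mulr_ge0 // ?prod_tilt_ge0 // indicE. Qed.

Lemma tilted_volume_ge0 s t A : 0 <= tilted_volume V s t A.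
Proof. by apply: tuple_integral_ge0 => y; exact: tilted_ge0. Qed.

(** Comparing exponents inside the domain suffices, since both weights vanish outside. Enlarging [A]
    to the whole space for s' < 0 gives the Chebyshev bound; s' = t' = 0 undoes a tilt. *)
Lemma tilted_volume_change s t s' t' k A : measurable A ->
  (forall y, A y -> dom_tuple V n y ->
    s * energy V y + t * sumsq y + k <= s' * energy V y + t' * sumsq y)%R ->
  tilted_volume V s t A <= (expR (- k))%:E * tilted_volume V s' t' A.
Proof.
move=> mA H; rewrite /tilted_volume -tuple_integralZ; last 1 first.
- exact: expR_ge0.
- apply: le_tuple_integral => //.
  + exact: measurable_tilted.
  + by apply: measurable_funeM; exact: measurable_tilted.
  + by move=> y; exact: tilted_ge0.
  move=> y; rewrite -EFinM lee_fin indicE.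
  have [/set_mem Ay|nAy] := boolP (y \in A); last by rewrite !mulr0.
  rewrite !mulr1.
  have [Dy|nDy] := pselect (dom_tuple V n y); last by rewrite !prod_tilt_out // mulr0.
  rewrite !prod_tiltE // -expRD ler_expR.
  by have := H y Ay Dy; lra.
- exact: measurable_tilted.
- by move=> y; exact: tilted_ge0.
Qed.

Lemma tilted_volumeS s t A B : measurable A -> measurable B -> A `<=` B ->
  tilted_volume V s t A <= tilted_volume V s t B.
Proof.
move=> mA mB AB; apply: le_tuple_integral.
- exact: measurable_tilted.
- exact: measurable_tilted.
- by move=> y; exact: tilted_ge0.
move=> y; rewrite lee_fin ler_wpM2l ?prod_tilt_ge0 // !indicE.
have [/set_mem Ay|//] := boolP (y \in A).
by rewrite (mem_set (AB _ Ay)).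
Qed.

Lemma tilted_volumeU s t A B : measurable A -> measurable B ->
  tilted_volume V s t (A `|` B) <= tilted_volume V s t A + tilted_volume V s t B.
Proof.
move=> mA mB; rewrite /tilted_volume -tuple_integralD; last 4 first.
- exact: measurable_tilted.
- exact: measurable_tilted.
- by move=> y; exact: tilted_ge0.
- by move=> y; exact: tilted_ge0.
apply: le_tuple_integral.
- by apply: measurable_tilted; exact: measurableU.
- by apply: emeasurable_funD; exact: measurable_tilted.
- by move=> y; exact: tilted_ge0.
move=> y; rewrite -EFinD lee_fin -mulrDr ler_wpM2l ?prod_tilt_ge0 // !indicE in_setU.
by case: (y \in A); case: (y \in B) => /=; rewrite ?addr0 ?add0r // lerDl.
Qed.

Lemma tilted_volume_dom s t A : measurable A ->
  measurable (A `&` dom_tuple V n) ->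
  tilted_volume V s t A = tilted_volume V s t (A `&` dom_tuple V n).
Proof.
move=> mA mAD; apply: eq_tuple_integral => y; congr _%:E.
have [Dy|nDy] := pselect (dom_tuple V n y); last by rewrite !prod_tilt_out // !mul0r.
by rewrite !indicE in_setI (mem_set Dy) andbT.
Qed.

Lemma lebesgue_tuple_tilted A : A `<=` dom_tuple V n ->
  lebesgue_tuple A = tilted_volume V 0 0 A.
Proof.
move=> AD; rewrite lebesgue_tupleE; apply: eq_tuple_integral => y; congr _%:E.
rewrite indicE; have [/set_mem Ay|nAy] := boolP (y \in A); last by rewrite mulr0.
by rewrite prod_tiltE ?mul0r ?add0r ?expR0 ?mulr1 //; exact: AD.
Qed.

Lemma measurable_energy : measurable_fun setT (@energy R V n).
Proof.
apply: measurable_sum => i.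
apply: (@measurableT_comp _ _ _ _ _ _ (fine \o V)).
  exact: measurable_fine_orlicz.
exact: measurable_tnth.
Qed.

Lemma measurable_sumsq : measurable_fun setT (@sumsq R n).
Proof.
apply: measurable_sum => i.
apply: (@measurableT_comp _ _ _ _ _ _ (fun x : R => x ^+ 2)%R) => //.
exact: measurable_tnth.
Qed.

Lemma measurable_dom_tuple : measurable (dom_tuple V n).
Proof.
rewrite (_ : dom_tuple V n = \bigcap_(i in [set: 'I_n])
  ((fun y : n.-tuple R => tnth y i) @^-1` orlicz_dom V)).
  apply: fin_bigcap_measurable => // i _.
  rewrite -[_ @^-1` _]setTI; apply: measurable_tnth => //.
  exact: measurable_orlicz_dom.
by apply/seteqP; split => y /= H i; [move=> _; exact: H|exact: (H i Logic.I)].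
Qed.

Lemma energyE y : dom_tuple V n y ->
  (energy V y)%:E = \sum_(i < n) V (tnth y i).
Proof.
by move=> Dy; rewrite /energy -sumEFin; apply: eq_bigr => i _; exact: orlicz_fin.
Qed.

Lemma orlicz_ballE :
  orlicz_ball V n = dom_tuple V n `&` [set y | (energy V y <= n%:R)%R].
Proof.
apply/seteqP; split => y /=; rewrite /orlicz_ball /=.
  move=> Hy; have Dy : dom_tuple V n y.
    move=> i; rewrite (@le_lt_trans _ _ n%:R%:E) ?ltry //.
    apply: le_trans Hy; rewrite (bigD1 i) //= leeDl // sume_ge0 // => j _.
    exact: orlicz_ge0.
  by split=> //; rewrite -lee_fin energyE.
by move=> [Dy]; rewrite -lee_fin energyE.
Qed.

Lemma measurable_orlicz_ball : measurable (orlicz_ball V n).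
Proof.
rewrite orlicz_ballE; apply: measurableI; first exact: measurable_dom_tuple.
by apply: measurable_le_cst; exact: measurable_energy.
Qed.

Hypothesis V_superquadratic : superquadratic V.

Lemma tilted_volumeT s t : (s < 0)%R ->
  tilted_volume V s t [set: n.-tuple R] = (partition_fun V s t ^+ n)%:E.
Proof.
move=> s0; rewrite -(@tuple_integral_prod _ _ (tilt V s t)).
- by apply: eq_tuple_integral => y; rewrite indicT mulr1.
- exact: measurable_tilt.
- by move=> x; exact: tilt_ge0.
- exact: partitionE.
Qed.

Lemma tilted_volume_le s t s' t' k A : measurable A -> (s' < 0)%R ->
  (forall y, A y -> dom_tuple V n y ->
    s * energy V y + t * sumsq y + k <= s' * energy V y + t' * sumsq y)%R ->
  tilted_volume V s t A <= (expR (- k) * partition_fun V s' t' ^+ n)%:E.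
Proof.
move=> mA s0 H; apply: le_trans (tilted_volume_change mA H) _.
rewrite EFinM -tilted_volumeT //; apply: lee_wpmul2l; first by rewrite lee_fin expR_ge0.
by apply: tilted_volumeS.
Qed.

End tilted_volume_theory.

(** * Tilts from near-maximizers *)

Lemma mul_expR_le_ln (R : realType) (x y a : R) : (0 < x)%R -> (0 < y)%R ->
  ((x * expR a <= y) = (ln x + a <= ln y))%R.
Proof.
move=> x0 y0; rewrite -[x in LHS]lnK ?posrE // -[y in LHS]lnK ?posrE //.
by rewrite -expRD ler_expR.
Qed.

(** The remainder is kept as an exponential in [h], so that after integration it is again a value of
    the partition function. It comes from y^2 e^y with y = (l / l0) z, z = l0 h, and z^2 <= 4
    e^z. *)
Lemma expR_second_difference (R : realType) (h l l0 : R) :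
  (0 <= h)%R -> (0 < l)%R -> (l <= l0)%R ->
  (expR (l * h) + expR (- (l * h)) <=
     2 + 4 * (l / l0) ^+ 2 * expR (2 * l0 * h))%R.
Proof.
move=> h0 lp ll0; have l0p : (0 < l0)%R := lt_le_trans lp ll0.
set y := (l * h)%R; set z := (l0 * h)%R.
have y0 : (0 <= y)%R by rewrite mulr_ge0 // ltW.
have yz : (y <= z)%R by rewrite ler_wpM2r.
have yE : y = (l / l0 * z)%R by rewrite /y /z; field; exact: lt0r_neq0.
have e2 : (expR (2 * l0 * h) = expR z * expR z)%R.
  by rewrite -expRD; congr expR; rewrite /z; ring.
have eN : (expR (- y) * expR y = 1)%R by rewrite -expRD addNr expR0.
have ey0 := expR_gt0 y; have eNy0 := expR_gt0 (- y).
have ey1 := expR_ge1Dx (- y).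
have eyz : (expR y <= expR z)%R by rewrite ler_expR.
have zsq : (z ^+ 2 <= 4 * expR z)%R.
  have ez2 : expR z = (expR (z / 2) ^+ 2)%R.
    by rewrite expr2 -expRD; congr expR; field.
  have := expR_ge1Dx (z / 2); rewrite ez2 => H.
  have z0 : (0 <= z)%R := le_trans y0 yz.
  rewrite -subr_ge0.
  have -> : (4 * expR (z / 2) ^+ 2 - z ^+ 2 =
     (2 * expR (z / 2) - z) * (2 * expR (z / 2) + z))%R by ring.
  by apply: mulr_ge0; lra.
(* The left side is (e^y - 1)^2 e^(-y), and e^y - 1 = e^y (1 - e^(-y)) <= y e^y. *)
have step : (expR y + expR (- y) - 2 <= y ^+ 2 * expR y)%R.
  have -> : (expR y + expR (- y) - 2 = (expR y * (1 - expR (- y))) ^+ 2 * expR (- y))%R.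
    have -> : (expR y * (1 - expR (- y)) = expR y - expR (- y) * expR y)%R by ring.
    rewrite eN; have -> : ((expR y - 1) ^+ 2 * expR (- y) =
      expR y * (expR (- y) * expR y) - 2 * (expR (- y) * expR y) + expR (- y))%R by ring.
    by rewrite eN; ring.
  have eN1 : (expR (- y) <= 1)%R by rewrite -expR0 ler_expR oppr_le0.
  have -> : (y ^+ 2 * expR y = (expR y * y) ^+ 2 * expR (- y))%R.
    by rewrite -[LHS]mulr1 -eN; ring.
  apply: ler_wpM2r; first exact: ltW.
  have A0 : (0 <= expR y * (1 - expR (- y)))%R by rewrite mulr_ge0 ?(ltW ey0) ?subr_ge0.
  have AB : (expR y * (1 - expR (- y)) <= expR y * y)%R.
    by apply: ler_wpM2l; [exact: ltW|lra].
  by rewrite ler_sqr // nnegrE // (le_trans A0).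
suff : (y ^+ 2 * expR y <= 4 * (l / l0) ^+ 2 * (expR z * expR z))%R by rewrite e2; lra.
have -> : (4 * (l / l0) ^+ 2 * (expR z * expR z) =
  ((l / l0) ^+ 2 * (4 * expR z)) * expR z)%R by ring.
apply: ler_pM => //; first exact: sqr_ge0.
rewrite yE exprMn; apply: ler_wpM2l => //; exact: sqr_ge0.
Qed.

(** A substitute for differentiating ln Z, with [m] as the slope: through the second difference, a
    lower bound on one neighbour [Zm] becomes an upper bound on the other, [Zp]. The slack l d / 4
    of the hypothesis and an equal one for the remainder [C] add up to l d / 2. *)
Lemma tail_ratio (R : realType) (Z Zp Zm Z0 C l m d : R) :
  (0 < Z0)%R -> (Z0 <= Z)%R -> (0 < l)%R -> (0 <= d)%R ->
  (Zp + Zm <= 2 * Z + l ^+ 2 * C)%R -> (l * C <= Z0 * (d / 4))%R ->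
  (Z * expR (- (l * m) - l * d / 4) <= Zm)%R ->
  (Zp <= Z * expR (l * m + l * d / 2))%R.
Proof.
move=> Z0p Z0Z lp d0 HZ HC Hm.
have Zp0 : (0 < Z)%R := lt_le_trans Z0p Z0Z.
have H1 : (Z * (1 + (- (l * m) - l * d / 4)) <= Z * expR (- (l * m) - l * d / 4))%R.
  by rewrite ler_wpM2l ?(ltW Zp0) // expR_ge1Dx.
have H2 : (Z * (1 + (l * m + l * d / 2)) <= Z * expR (l * m + l * d / 2))%R.
  by rewrite ler_wpM2l ?(ltW Zp0) // expR_ge1Dx.
have H3 : (l ^+ 2 * C <= l * (Z0 * (d / 4)))%R by rewrite expr2 -mulrA ler_wpM2l // ltW.
have H4 : (l * (Z0 * (d / 4)) <= l * (Z * (d / 4)))%R.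
  by rewrite ler_wpM2l ?(ltW lp) // ler_wpM2r // divr_ge0.
lra.
Qed.

(** * Monotonicity and second differences of the partition function *)

Section partition_theory.
Context {R : realType} (V : R -> \bar R).
Hypotheses (V_orlicz : orlicz V) (V_superquadratic : superquadratic V).
Hypothesis V_nontrivial : exists2 a : R, (0 < a)%R & V a < +oo.
Local Notation mu := (@lebesgue_measure R).
Local Notation Z := (partition_fun V).

Lemma measurable_EFin_tilt s t : measurable_fun setT (fun x => (tilt V s t x)%:E).
Proof. by apply: measurableT_comp => //; exact: measurable_tilt. Qed.

Lemma le_partition s t s' t' : (s < 0)%R -> (s' < 0)%R -> (s <= s')%R ->
  (t <= t')%R -> (Z s t <= Z s' t')%R.
Proof.
move=> s0 s'0 ss tt; rewrite -lee_fin -!partitionE //.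
apply: ge0_le_integral => //.
- by move=> x _; rewrite lee_fin tilt_ge0.
- exact: measurable_EFin_tilt.
- exact: measurable_EFin_tilt.
move=> x _; rewrite lee_fin /tilt; case: ifP => // _; rewrite ler_expR.
apply: lerD; first by rewrite ler_wpM2r // fine_orlicz_ge0.
by rewrite ler_wpM2r // sqr_ge0.
Qed.

Lemma partition_second_difference s1 t1 s2 t2 s t s' t' k :
  (s1 < 0)%R -> (s2 < 0)%R -> (s < 0)%R -> (s' < 0)%R -> (0 <= k)%R ->
  (forall x, tilt V s1 t1 x + tilt V s2 t2 x
     <= 2 * tilt V s t x + k * tilt V s' t' x)%R ->
  (Z s1 t1 + Z s2 t2 <= 2 * Z s t + k * Z s' t')%R.
Proof.
move=> s10 s20 s0 s'0 k0 H.
rewrite -lee_fin !EFinD !EFinM -!partitionE //.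
have t_ge0 a b x : 0 <= (tilt V a b x)%:E by rewrite lee_fin tilt_ge0.
have m a b := measurable_EFin_tilt a b.
have mZ (q : R) a b : measurable_fun setT (fun x => q%:E * (tilt V a b x)%:E).
  exact: measurable_funeM.
have Z_ge0 (q : R) a b x : (0 <= q)%R -> 0 <= q%:E * (tilt V a b x)%:E.
  by move=> q0; rewrite mule_ge0.
have intZ (q : R) a b : (0 <= q)%R ->
    q%:E * \int[mu]_x (tilt V a b x)%:E = \int[mu]_x (q%:E * (tilt V a b x)%:E).
  by move=> q0; rewrite ge0_integralZl_EFin //; exact: m.
rewrite !intZ //.
have intD (f g : R -> \bar R) : measurable_fun setT f -> measurable_fun setT g ->
    (forall x, 0 <= f x) -> (forall x, 0 <= g x) ->
    \int[mu]_x f x + \int[mu]_x g x = \int[mu]_x (f x + g x).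
  by move=> mf mg f0 g0; rewrite ge0_integralD.
rewrite !intD //; last 2 first.
- by move=> x; exact: Z_ge0.
- by move=> x; exact: Z_ge0.
apply: ge0_le_integral => //.
- by move=> x _; rewrite adde_ge0.
- by apply: emeasurable_funD; exact: m.
- by apply: emeasurable_funD; exact: mZ.
- by move=> x _; rewrite -!EFinM -!EFinD lee_fin.
Qed.

(** Taking l0 = kappa / 4 makes the remainder weight e^(kappa V / 2), which a tilt s <= - kappa
    absorbs, leaving Z at - kappa / 2. The constant 64 is 4 times 4^2. *)
Lemma partition_second_difference_V kappa K s t l :
  (0 < kappa)%R -> (s <= - kappa)%R -> (t <= K)%R -> (0 < l)%R -> (l <= kappa / 4)%R ->
  (Z (s + l) t + Z (s - l) t
     <= 2 * Z s t + l ^+ 2 * (64 / kappa ^+ 2 * Z (- (kappa / 2)) K))%R.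
Proof.
move=> k0 sk tK l0 lk.
rewrite (mulrA (l ^+ 2)%R); apply: partition_second_difference; [lra..| |].
  by rewrite mulr_ge0 ?sqr_ge0 // divr_ge0 // sqr_ge0.
move=> x; rewrite /tilt; case: ifP => Vx; last by rewrite !mulr0.
set v := fine (V x); have v0 : (0 <= v)%R := fine_orlicz_ge0 V_orlicz x.
have := expR_second_difference v0 l0 lk.
have -> : (2 * (kappa / 4) * v = kappa / 2 * v)%R by field.
have -> : (4 * (l / (kappa / 4)) ^+ 2 = l ^+ 2 * (64 / kappa ^+ 2))%R.
  by field; exact: lt0r_neq0.
set q := (l ^+ 2 * _)%R => H.
have q0 : (0 <= q)%R by rewrite mulr_ge0 ?sqr_ge0 // divr_ge0 // sqr_ge0.
have -> : ((s + l) * v + t * x ^+ 2 = (s * v + t * x ^+ 2) + l * v)%R by ring.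
have -> : ((s - l) * v + t * x ^+ 2 = (s * v + t * x ^+ 2) + - (l * v))%R by ring.
rewrite !(expRD (s * v + t * x ^+ 2)) -mulrDr.
apply: le_trans (ler_wpM2l (expR_ge0 _) H) _.
rewrite mulrDr [(_ * 2)%R]mulrC lerD2l mulrCA; apply: ler_wpM2l => //.
rewrite -expRD ler_expR.
have x0 : (t * x ^+ 2 <= K * x ^+ 2)%R by rewrite ler_wpM2r // sqr_ge0.
have : (s * v <= - kappa * v)%R by rewrite ler_wpM2r.
lra.
Qed.

(** Here l0 = 1 and h = c x^2, so the remainder weight is at most e^(2 x^2), whence [K + 2]. The
    factor [c] treats the norm (c = 1) and the plain volume (c = 0) together. *)
Lemma partition_second_difference_sq kappa K s c t l :
  (0 < kappa)%R -> (s <= - kappa)%R -> (0 <= c <= 1)%R -> (c * t <= K)%R ->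
  (0 < l)%R -> (l <= 1)%R ->
  (Z s (c * (t + l)) + Z s (c * (t - l))
     <= 2 * Z s (c * t) + l ^+ 2 * (4 * Z (- kappa) (K + 2)))%R.
Proof.
move=> k0 sk /andP[c0 c1] tK l0 lk.
rewrite (mulrA (l ^+ 2)%R); apply: partition_second_difference; [lra..| |].
  by rewrite mulr_ge0 ?sqr_ge0.
move=> x; rewrite /tilt; case: ifP => Vx; last by rewrite !mulr0.
set v := fine (V x); have v0 : (0 <= v)%R := fine_orlicz_ge0 V_orlicz x.
have x20 : (0 <= x ^+ 2)%R := sqr_ge0 x.
have cx0 : (0 <= c * x ^+ 2)%R by rewrite mulr_ge0.
have := expR_second_difference cx0 l0 lk.
rewrite divr1 [(4 * _)%R]mulrC mulr1 => H.
have q0 : (0 <= l ^+ 2 * 4)%R by rewrite mulr_ge0 // sqr_ge0.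
have -> : (s * v + c * (t + l) * x ^+ 2 = (s * v + c * t * x ^+ 2) + l * (c * x ^+ 2))%R by ring.
have -> : (s * v + c * (t - l) * x ^+ 2 = (s * v + c * t * x ^+ 2) + - (l * (c * x ^+ 2)))%R by ring.
rewrite !(expRD (s * v + c * t * x ^+ 2)) -mulrDr.
apply: le_trans (ler_wpM2l (expR_ge0 _) H) _.
rewrite mulrDr [(_ * 2)%R]mulrC lerD2l mulrCA; apply: ler_wpM2l => //.
rewrite -expRD ler_expR.
have x0 : (c * t * x ^+ 2 <= K * x ^+ 2)%R by rewrite ler_wpM2r.
have x1 : (c * x ^+ 2 <= 1 * x ^+ 2)%R by rewrite ler_wpM2r.
have : (s * v <= - kappa * v)%R by rewrite ler_wpM2r.
lra.
Qed.

End partition_theory.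

Local Open Scope ring_scope.

(** [Z] is abstract: positivity, monotonicity and the two second-difference bounds suffice. [th1]
    and [th4] are the upper and lower thresholds for the average of V, [th2] and [th3] those for the
    average of c x^2, and [q] is the exponential rate of the tails beyond them. *)
Lemma near_maximizer_tilt (R : realType) (Z : R -> R -> R) (c u v M delta eta : R) :
  (forall s t, s < 0 -> 0 < Z s t) ->
  (forall s t s' t', s < 0 -> s' < 0 -> s <= s' -> t <= t' -> Z s t <= Z s' t') ->
  (forall kappa K s t l, 0 < kappa -> s <= - kappa ->
    t <= K -> 0 < l -> l <= kappa / 4 ->
    Z (s + l) t + Z (s - l) t
      <= 2 * Z s t + l ^+ 2 * (64 / kappa ^+ 2 * Z (- (kappa / 2)) K)) ->
  (forall kappa K s c t l, 0 < kappa ->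
    s <= - kappa -> 0 <= c <= 1 -> c * t <= K -> 0 < l -> l <= 1 ->
    Z s (c * (t + l)) + Z s (c * (t - l))
      <= 2 * Z s (c * t) + l ^+ 2 * (4 * Z (- kappa) (K + 2))) ->
  0 <= c <= 1 -> 0 < delta -> 0 < eta ->
  (forall s t, s < 0 -> s * u + t * v - ln (Z s (c * t)) <= M) ->
  exists s t l q : R, exists th1 th2 th3 th4 : R,
    [/\ [/\ s < 0, 0 < l, s + l < 0 & 0 < q],
        [/\ th1 <= u + delta, th2 <= v + delta, v - delta <= th3 &
            s * th4 <= s * u + eta],
        t * th2 <= t * v + eta /\ t * th3 <= t * v + eta,
        [/\ Z (s + l) (c * t) <= Z s (c * t) * expR (l * th1 - q),
            Z s (c * (t + l)) <= Z s (c * t) * expR (l * th2 - q) &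
            Z s (c * (t - l)) <= Z s (c * t) * expR (- (l * th3) - q)] &
        th4 = 0 \/ Z (s - l) (c * t) <= Z s (c * t) * expR (- (l * th4) - q)].
Proof.
move=> Z_gt0 le_Z Z_second_difference Z_second_difference_sq /andP[c0 c1] delta0 eta0 HM.
pose L s t := s * u + t * v - ln (Z s (c * t)).
(* The constants are fixed in the order [kappa], [C], [eps], [K], [d], [l], [eta1], all before the
   near-maximiser is picked. This [kappa] gives |s u| <= eta whenever - 2 kappa <= s < 0. *)
pose kappa := eta / (2 * (`|u| + 1)).
have u1 : 0 < `|u| + 1 by rewrite ltr_pwDr.
have k0 : 0 < kappa by rewrite divr_gt0 // mulr_gt0.
have ku : 2 * kappa * `|u| <= eta.
  rewrite /kappa; have -> : 2 * (eta / (2 * (`|u| + 1))) * `|u| = eta * (`|u| / (`|u| + 1)).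
    by field; exact: lt0r_neq0.
  by rewrite ler_piMr ?(ltW eta0) // ler_pdivrMr // mul1r lerDl.
have LM s t : s < 0 -> L s t <= M by exact: HM.
(* Comparison with the point (- kappa, 0) will give eps (s^2 + t^2) <= 2 C; the last summand covers
   [eta1]. *)
pose C := M - L (- kappa) 0 + kappa ^+ 2 + 1.
have C1 : 1 <= C.
  by have := LM (- kappa) 0; rewrite /C oppr_lt0 => /(_ k0); have := sqr_ge0 kappa; lra.
have C0 : 0 < C by apply: lt_le_trans C1.
(* Then (eps s)^2 <= 2 C eps <= delta^2 / 4, and likewise for t: the penalty shifts the gradient by
   at most delta / 2. *)
pose eps := Num.min 1 (delta ^+ 2 / (8 * C)).
have eps0 : 0 < eps.
  by rewrite lt_min ltr01 divr_gt0 ?exprn_gt0 // mulr_gt0.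
have eps1 : eps <= 1 by rewrite ge_min lexx.
have epsC : 8 * C * eps <= delta ^+ 2.
  by rewrite mulrC -ler_pdivlMr ?mulr_gt0 // ge_min lexx orbT.
pose K := 2 * C / eps + 1.
have K1 : 1 <= K by rewrite lerDr divr_ge0 ?mulr_ge0 // ltW.
have K0 : 0 < K by apply: lt_le_trans K1.
(* The other half of [delta] is the gradient error; K d <= eta bounds s d and t d. *)
pose d := Num.min (delta / 2) (eta / K).
have d0 : 0 < d by rewrite lt_min !divr_gt0.
have d1 : d <= delta / 2 by rewrite ge_min lexx.
have dK : K * d <= eta by rewrite mulrC -ler_pdivlMr // ge_min lexx orbT.
pose Z0 := Z (- K) (- K).
have Z0p : 0 < Z0 by apply: Z_gt0 => //; rewrite oppr_lt0.
pose CV := 64 / kappa ^+ 2 * Z (- (kappa / 2)) K.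
pose CQ := 4 * Z (- kappa) (K + 2).
have CV0 : 0 <= CV.
  rewrite mulr_ge0 ?divr_ge0 ?sqr_ge0 //; apply/ltW/Z_gt0 => //.
  by rewrite oppr_lt0 divr_gt0.
have CQ0 : 0 <= CQ.
  by rewrite mulr_ge0 //; apply/ltW/Z_gt0 => //; rewrite oppr_lt0.
pose l := Num.min (Num.min (kappa / 4) 1) (Num.min (d / 4) (Z0 * (d / 4) / (CV + CQ + 1))).
have CC : 0 < CV + CQ + 1 by lra.
have l0 : 0 < l by rewrite !lt_min ltr01 !divr_gt0 ?mulr_gt0 ?divr_gt0.
have lk : l <= kappa / 4 by rewrite !ge_min lexx.
have l1 : l <= 1 by rewrite !ge_min lexx orbT.
have ld : l <= d / 4 by rewrite !ge_min lexx !orbT.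
have lC : l * (CV + CQ + 1) <= Z0 * (d / 4).
  by rewrite -ler_pdivlMr // !ge_min lexx !orbT.
(* Near-maximality is used at distance [l] to detect slopes up to [d], so its tolerance must be of
   order l d. *)
pose eta1 := Num.min 1 (l * d / 8).
have e10 : 0 < eta1 by rewrite lt_min ltr01 divr_gt0 ?mulr_gt0.
have e11 : eta1 <= 1 by rewrite ge_min lexx.
have e1l : eta1 <= l * d / 8 by rewrite ge_min lexx orbT.
pose F s t := L s t - eps / 2 * (s ^+ 2 + t ^+ 2).
have eps2 : 0 < eps / 2 by rewrite divr_gt0.
pose S := [set F p.1 p.2 | p in [set p : R * R | p.1 <= - kappa]].
have S_sup : has_sup S.
  split; first by exists (F (- kappa) 0), (- kappa, 0) => //=.
  exists M => _ [[s t] /= sk <-]; rewrite /F.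
  have s0 : s < 0 by apply: le_lt_trans sk _; rewrite oppr_lt0.
  have := LM s t s0; have : 0 <= eps / 2 * (s ^+ 2 + t ^+ 2).
    by rewrite mulr_ge0 ?(ltW eps2) // addr_ge0 // sqr_ge0.
  lra.
have [_ [[s t] /= sk <-] Hst] := sup_adherent e10 S_sup.
have near_max s' t' : s' <= - kappa -> F s' t' <= F s t + eta1.
  move=> s'k; have : F s' t' <= sup S.
    by apply: sup_upper_bound => //; exists (s', t').
  lra.
have s0 : s < 0 by apply: le_lt_trans sk _; rewrite oppr_lt0.
have quad : eps * (s ^+ 2 + t ^+ 2) <= 2 * C.
  have := near_max (- kappa) 0 (lexx _); rewrite /F expr0n /= sqrrN addr0.
  have : eps * kappa ^+ 2 <= 1 * kappa ^+ 2 by rewrite ler_wpM2r // sqr_ge0.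
  have := LM s t s0; have := sqr_ge0 kappa; rewrite /C; clear - e11 eps1; lra.
have bound x : x ^+ 2 <= s ^+ 2 + t ^+ 2 -> `|x| <= K /\ `|eps * x| <= delta / 2.
  move=> xst; have qx : eps * x ^+ 2 <= 2 * C.
    by apply: le_trans quad; rewrite ler_wpM2l // ltW.
  split.
    have : x ^+ 2 <= 2 * C / eps by rewrite ler_pdivlMr // mulrC.
    rewrite -real_normK ?num_real // => H.
    have := sqr_ge0 (`|x| - 1); move: K1; rewrite /K sqrrB1; clear - H; lra.
  rewrite -ler_sqr ?nnegrE ?divr_ge0 ?(ltW delta0) // real_normK ?num_real //.
  have -> : (eps * x) ^+ 2 = eps * (eps * x ^+ 2) by ring.
  have : eps * (eps * x ^+ 2) <= eps * (2 * C) by rewrite ler_wpM2l // ltW.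
  rewrite expr_div_n; clear - epsC; lra.
have [sK es] : `|s| <= K /\ `|eps * s| <= delta / 2 by apply: bound; rewrite lerDl sqr_ge0.
have [tK et] : `|t| <= K /\ `|eps * t| <= delta / 2 by apply: bound; rewrite lerDr sqr_ge0.
clear bound quad.
clearbody K eps; clear C1 C0 epsC C.
clear HM LM Hst S_sup S.
move: sK; rewrite ler_norml => /andP[sK1 sK2].
move: tK; rewrite ler_norml => /andP[tK1 tK2].
move: es; rewrite ler_norml => /andP[es1 es2].
move: et; rewrite ler_norml => /andP[et1 et2].
have ctK : - K <= c * t <= K.
  by rewrite -ler_norml normrM (ger0_norm c0); apply: le_trans (_ : `|t| <= K); rewrite ?ler_piMl // ler_norml tK1.
case/andP: ctK => ctK1 ctK2.
have Z0Z : Z0 <= Z s (c * t).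
  by apply: le_Z => //; rewrite oppr_lt0.
have Zp : 0 < Z s (c * t) by apply: lt_le_trans Z0Z.

(* Near-maximality, read as a lower bound for Z at a displaced point relative to Z at the
   near-maximiser. *)
have step s' t' a : s' <= - kappa ->
    a <= (s' - s) * u + (t' - t) * v
         - eps / 2 * (s' ^+ 2 + t' ^+ 2 - s ^+ 2 - t ^+ 2) - eta1 ->
    Z s (c * t) * expR a <= Z s' (c * t').
  move=> s'k Ha; have s'0 : s' < 0 by apply: le_lt_trans s'k _; rewrite oppr_lt0.
  have Z'p : 0 < Z s' (c * t') by exact: Z_gt0.
  rewrite mul_expR_le_ln //.
  have := near_max s' t' s'k; rewrite /F /L; clear - Ha; lra.
clear near_max F L.
have hl2 : eps / 2 * l ^+ 2 <= l * (d / 8).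
  have : eps * l ^+ 2 <= 1 * l ^+ 2 by rewrite ler_wpM2r // sqr_ge0.
  have : l * l <= l * (d / 4) by rewrite ler_wpM2l // ltW.
  rewrite expr2; clear; lra.
have lCV : l * CV <= Z0 * (d / 4).
  apply: le_trans lC; rewrite ler_wpM2l ?(ltW l0) //; clear - CQ0; lra.
have lCQ : l * CQ <= Z0 * (d / 4).
  apply: le_trans lC; rewrite ler_wpM2l ?(ltW l0) //; clear - CV0; lra.
have DV := Z_second_difference _ _ _ _ _ k0 sk ctK2 l0 lk.
have DQ : Z s (c * (t + l)) + Z s (c * (t - l)) <=
    2 * Z s (c * t) + l ^+ 2 * CQ.
  by apply: Z_second_difference_sq; rewrite ?c0.
have d0' := ltW d0.
(* Exact stationarity of the penalised function would make these the partial derivatives of ln Z(s,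
   c t). *)
pose mV := u - eps * s; pose mg := v - eps * t.
have sld : - s * d <= eta.
  by apply: le_trans dK; rewrite ler_wpM2r //; clear - sK1; lra.
have tld : t * d <= eta /\ - t * d <= eta.
  by split; apply: le_trans dK; rewrite ler_wpM2r //; clear - tK1 tK2; lra.
have Q1 : Z (s + l) (c * t) <= Z s (c * t) * expR (l * (mV + d) - l * d / 2).
  have -> : l * (mV + d) - l * d / 2 = l * mV + l * d / 2 by field.
  apply: (tail_ratio Z0p Z0Z l0 d0' DV lCV).
  by apply: step; rewrite /mV; clear - sk l0 hl2 e1l; lra.
have Q2 : Z s (c * (t + l)) <= Z s (c * t) * expR (l * (mg + d) - l * d / 2).
  have -> : l * (mg + d) - l * d / 2 = l * mg + l * d / 2 by field.
  apply: (tail_ratio Z0p Z0Z l0 d0' DQ lCQ).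
  by apply: step; rewrite /mg; clear - sk l0 hl2 e1l; lra.
have Q3 : Z s (c * (t - l)) <= Z s (c * t) * expR (- (l * (mg - d)) - l * d / 2).
  have -> : - (l * (mg - d)) - l * d / 2 = l * (- mg) + l * d / 2 by field.
  rewrite addrC in DQ.
  apply: (tail_ratio Z0p Z0Z l0 d0' DQ lCQ).
  by apply: step; rewrite /mg; clear - sk l0 hl2 e1l; lra.
have [th4 th4s Q4] : exists2 th4, s * th4 <= s * u + eta &
    th4 = 0 \/ Z (s - l) (c * t) <= Z s (c * t) * expR (- (l * th4) - l * d / 2).
  (* Bounding Z at s - l uses s + l as comparison point, which must not exceed - kappa. Otherwise s
     is so close to - kappa that |s u| <= eta, and the threshold 0 is good enough. *)
  have [slk|slk] := leP (s + l) (- kappa).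
    exists (mV - d).
      have := mulr_ge0 (ltW eps0) (sqr_ge0 s); rewrite /mV; clear - sld; lra.
    right; have -> : - (l * (mV - d)) - l * d / 2 = l * (- mV) + l * d / 2 by field.
    rewrite addrC in DV.
    apply: (tail_ratio Z0p Z0Z l0 d0' DV lCV).
    by apply: step => //; rewrite /mV; clear - hl2 e1l; lra.
  exists 0; last by left.
  have : `|s * u| <= eta.
    rewrite normrM; apply: le_trans ku; rewrite ler_wpM2r // ler0_norm ?(ltW s0) //.
    clear - slk lk k0; lra.
  by rewrite ler_norml => /andP[]; clear; lra.
exists s, t, l, (l * d / 2), (mV + d), (mg + d), (mg - d), th4; split=> //.
- split=> //; first by clear - sk lk k0; lra.
  by rewrite divr_gt0 ?mulr_gt0.
- by split=> //; rewrite /mV /mg; clear - es1 es2 et1 et2 d1; lra.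
- have := mulr_ge0 (ltW eps0) (sqr_ge0 t); case: tld; rewrite /mg; clear => ? ? ?.
  by split; lra.
Qed.

Lemma exists_tilt (R : realType) (V : R -> \bar R) (c u v M delta eta : R)
    (Z := partition_fun V) :
  orlicz V -> superquadratic V -> (exists2 a : R, 0 < a & (V a < +oo)%E) ->
  0 <= c <= 1 -> 0 < delta -> 0 < eta ->
  (forall s t, s < 0 -> s * u + t * v - ln (Z s (c * t)) <= M) ->
  exists s t l q : R, exists th1 th2 th3 th4 : R,
    [/\ [/\ s < 0, 0 < l, s + l < 0 & 0 < q],
        [/\ th1 <= u + delta, th2 <= v + delta, v - delta <= th3 &
            s * th4 <= s * u + eta],
        t * th2 <= t * v + eta /\ t * th3 <= t * v + eta,
        [/\ Z (s + l) (c * t) <= Z s (c * t) * expR (l * th1 - q),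
            Z s (c * (t + l)) <= Z s (c * t) * expR (l * th2 - q) &
            Z s (c * (t - l)) <= Z s (c * t) * expR (- (l * th3) - q)] &
        th4 = 0 \/ Z (s - l) (c * t) <= Z s (c * t) * expR (- (l * th4) - q)].
Proof.
move=> Vo Vs Vn; apply: near_maximizer_tilt.
- by move=> s t; exact: partition_gt0.
- by move=> s t s' t'; exact: le_partition.
- by move=> kappa K s t l; exact: partition_second_difference_V.
- by move=> kappa K s c' t l; exact: partition_second_difference_sq.
Qed.

(** * Volume bounds *)

Lemma eventually_le_natmul (R : realType) (q K : R) : 0 < q ->
  exists N, forall n, (N <= n)%N -> K <= n%:R * q.
Proof.
move=> q0; exists (Num.truncn (K / q)).+1 => n Nn.
rewrite -ler_pdivrMr //; apply: ltW; apply: lt_le_trans (truncnS_gt _) _.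
by rewrite ler_nat.
Qed.

(** The energy is bounded from above only, as in the ball. With c = v = 0 and d >= 0 the last
    condition is void. *)
Definition window (R : realType) (V : R -> \bar R) (n : nat) (e c v d : R) :
    set (n.-tuple R) :=
  [set y | [/\ dom_tuple V n y, energy V y <= n%:R * e &
               `|c * sumsq y - n%:R * v| <= n%:R * d]].
Arguments window [R] V n e c v d.

Section lower_bound_volume.
Context {R : realType} (V : R -> \bar R).
Hypotheses (V_orlicz : orlicz V) (V_superquadratic : superquadratic V).
Hypothesis V_nontrivial : exists2 a : R, 0 < a & (V a < +oo)%E.
Local Notation Z := (partition_fun V).

Lemma energy_ge0 n (y : n.-tuple R) : 0 <= energy V y.
Proof. by apply: sumr_ge0 => i _; exact: fine_orlicz_ge0. Qed.

(** Exponential Chebyshev: on [B] the change of tilt gains a factor e^(- n a), while Z grows by at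
    most e^(a - q) per coordinate. *)
Lemma tilted_volume_tail n (B : set (n.-tuple R)) (s t s' t' a q : R) :
  measurable B -> s' < 0 -> 0 < Z s t -> Z s' t' <= Z s t * expR (a - q) ->
  (forall y, B y -> dom_tuple V n y ->
    s * energy V y + t * sumsq y + n%:R * a <= s' * energy V y + t' * sumsq y) ->
  (tilted_volume V s t B <= (Z s t ^+ n * expR (- (n%:R * q)))%:E)%E.
Proof.
move=> mB s'0 Z0 HZ HB.
apply: le_trans (tilted_volume_le V_orlicz V_superquadratic mB s'0 HB) _.
rewrite lee_fin.
have Z'0 : 0 <= Z s' t' by apply/ltW/partition_gt0.
have -> : Z s t ^+ n * expR (- (n%:R * q)) =
    expR (- (n%:R * a)) * (Z s t * expR (a - q)) ^+ n.
  by rewrite exprMn -expRM_natl mulrCA -expRD; congr (_ * expR _); ring.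
rewrite ler_wpM2l ?expR_ge0 //; apply: lerXn2r => //; rewrite nnegrE //.
by apply: mulr_ge0; [exact: ltW|exact: expR_ge0].
Qed.

Lemma measurable_window n (e c v d : R) : measurable (window V n e c v d).
Proof.
rewrite (_ : window _ _ _ _ _ _ = dom_tuple V n `&` ([set y | energy V y <= n%:R * e] `&`
   [set y : n.-tuple R | `|c * sumsq y - n%:R * v| <= n%:R * d])).
  apply: measurableI; first exact: measurable_dom_tuple.
  apply: measurableI; first by apply: measurable_le_cst; exact: measurable_energy.
  apply: measurable_le_cst; apply: measurableT_comp => //.
  apply: measurable_funB => //; apply: measurable_funM => //.
  exact: measurable_sumsq.
by apply/seteqP; split => y /= [] // ? [].
Qed.

(* Under the tilted measure each of the four constraints fails with exponentially
   small probability, so half of the tilted mass satisfies all of them. *)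
Lemma tilted_volume_half n (s t c l q th1 th2 th3 th4 : R)
    (G := [set y : n.-tuple R | [/\ energy V y <= n%:R * th1, c * sumsq y <= n%:R * th2,
       n%:R * th3 <= c * sumsq y & n%:R * th4 <= energy V y]]) :
  s < 0 -> 0 < l -> s + l < 0 -> 7 <= n%:R * q ->
  Z (s + l) (c * t) <= Z s (c * t) * expR (l * th1 - q) ->
  Z s (c * (t + l)) <= Z s (c * t) * expR (l * th2 - q) ->
  Z s (c * (t - l)) <= Z s (c * t) * expR (- (l * th3) - q) ->
  (th4 = 0 \/ Z (s - l) (c * t) <= Z s (c * t) * expR (- (l * th4) - q)) ->
  measurable G /\
  ((Z s (c * t) ^+ n / 2)%:E <= tilted_volume V s (c * t) G)%E.
Proof.
move=> s0 l0 sl0 nq Q1 Q2 Q3 Q4.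
have Zp : 0 < Z s (c * t) by exact: partition_gt0.
pose G1 := [set y : n.-tuple R | energy V y <= n%:R * th1].
pose G2 := [set y : n.-tuple R | c * sumsq y <= n%:R * th2].
pose G3 := [set y : n.-tuple R | n%:R * th3 <= c * sumsq y].
pose G4 := [set y : n.-tuple R | n%:R * th4 <= energy V y].
have mE : measurable_fun setT (@energy R V n) := measurable_energy V_orlicz.
have mQ : measurable_fun setT (fun y : n.-tuple R => c * sumsq y).
  by apply: measurable_funM => //; exact: measurable_sumsq.
have mG1 : measurable G1 by exact: measurable_le_cst.
have mG2 : measurable G2 by apply: (measurable_le_cst _ mQ).
have mG3 : measurable G3 by apply: (measurable_ge_cst _ mQ).
have mG4 : measurable G4 by exact: measurable_ge_cst.
have GE : G = G1 `&` G2 `&` (G3 `&` G4).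
  by apply/seteqP; split => y /=; [move=> [? ? ? ?]|move=> [[? ?] [? ?]]].
have mG : measurable G by rewrite GE; apply: measurableI; exact: measurableI.
split=> //.
pose tail := (Z s (c * t) ^+ n * expR (- (n%:R * q))).
have T1 : (tilted_volume V s (c * t) (~` G1) <= tail%:E)%E.
  apply: (tilted_volume_tail (measurableC mG1) sl0 Zp Q1) => y /= /negP.
  rewrite -ltNge => /ltW Hy _.
  have := ler_wpM2l (ltW l0) Hy; clear; lra.
have T2 : (tilted_volume V s (c * t) (~` G2) <= tail%:E)%E.
  apply: (tilted_volume_tail (measurableC mG2) s0 Zp Q2) => y /= /negP.
  rewrite -ltNge => /ltW Hy _.
  have := ler_wpM2l (ltW l0) Hy; clear; lra.
have T3 : (tilted_volume V s (c * t) (~` G3) <= tail%:E)%E.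
  apply: (tilted_volume_tail (measurableC mG3) s0 Zp Q3) => y /= /negP.
  rewrite -ltNge => /ltW Hy _.
  have := ler_wpM2l (ltW l0) Hy; clear; lra.
have T4 : (tilted_volume V s (c * t) (~` G4) <= tail%:E)%E.
  case: Q4 => [th40|Q4].
    (* The complement of [G4] is empty since the energy is nonnegative; keeping the tilt and taking
       a = q makes the condition on Z an equality. *)
    apply: (@tilted_volume_tail _ _ _ _ s (c * t) q _ (measurableC mG4)) => //.
      by rewrite subrr expR0 mulr1.
    by move=> y /= /negP; rewrite th40 mulr0 energy_ge0.
  have sl0' : s - l < 0 by rewrite subr_lt0 (lt_trans s0).
  apply: (tilted_volume_tail (measurableC mG4) sl0' Zp Q4) => y /= /negP.
  rewrite -ltNge => /ltW Hy _.
  have := ler_wpM2l (ltW l0) Hy; clear; lra.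
have HG : (((Z s (c * t)) ^+ n)%:E <= tilted_volume V s (c * t) G +
     (tail%:E + tail%:E + (tail%:E + tail%:E)))%E.
  rewrite -tilted_volumeT //.
  have mC12 : measurable (~` G1 `|` ~` G2) by apply: measurableU; exact: measurableC.
  have mC34 : measurable (~` G3 `|` ~` G4) by apply: measurableU; exact: measurableC.
  rewrite (_ : [set: n.-tuple R] = G `|` ((~` G1 `|` ~` G2) `|` (~` G3 `|` ~` G4))); last first.
    by rewrite GE -!setCI setUCr.
  apply: le_trans (tilted_volumeU _ _ _ _ _) _ => //; first exact: measurableU.
  apply: leeD => //.
  apply: le_trans (tilted_volumeU _ _ _ _ _) _ => //.
  apply: leeD.
    apply: le_trans (tilted_volumeU _ _ _ _ _) _ => //; try exact: measurableC.
    exact: leeD.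
  apply: le_trans (tilted_volumeU _ _ _ _ _) _ => //; try exact: measurableC.
  exact: leeD.
(* Since e^(n q) >= 1 + n q >= 8, the four tails together take at most half of the mass. *)
have eq8 : expR (- (n%:R * q)) <= 1 / 8.
  rewrite expRN div1r lef_pV2 ?posrE ?expR_gt0 //.
  by apply: le_trans (expR_ge1Dx _); clear - nq; lra.
have tail8 : tail <= Z s (c * t) ^+ n * (1 / 8) by apply: ler_wpM2l => //; apply: exprn_ge0; exact: ltW.
have tv0 := tilted_volume_ge0 V s (c * t) G.
move: HG tv0; case: (tilted_volume V s (c * t) G) => [r| |] H _ //; last by rewrite leey.
move: H tail8; rewrite -!EFinD !lee_fin; clear; lra.
Qed.

Lemma volume_lower_bound (c u v M delta eta : R) :
  0 <= c <= 1 -> 0 < delta -> 0 < eta ->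
  (forall s t, s < 0 -> s * u + t * v - ln (Z s (c * t)) <= M) ->
  exists N, forall n, (N <= n)%N ->
    ((expR (- (n%:R * (M + eta))))%:E
       <= lebesgue_tuple (window V n (u + delta) c v delta))%E.
Proof.
move=> c01 delta0 eta0 HM.
(* The three thirds pay for the errors in s u and t v and for the factor 1/2 of
   [tilted_volume_half]. *)
have eta3 : 0 < eta / 3 by rewrite divr_gt0.
have [s [t [l [q [th1 [th2 [th3 [th4 [[s0 l0 sl0 q0] [h1 h2 h3 h4] [k2 k3] [Q1 Q2 Q3] Q4]]]]]]]]] :=
  exists_tilt V_orlicz V_superquadratic V_nontrivial c01 delta0 eta3 HM.
have [N1 HN1] := eventually_le_natmul 7 q0.
have [N2 HN2] := eventually_le_natmul 1 eta3.
exists (maxn N1 N2) => n; rewrite geq_max => /andP[/HN1 nq /HN2 neta].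
have n0 : 0 <= n%:R :> R by [].
have Zp : 0 < Z s (c * t) by exact: partition_gt0.
have [mG half] := tilted_volume_half s0 l0 sl0 nq Q1 Q2 Q3 Q4.
set G := [set y | _] in mG half.
have ee2 : expR (- (n%:R * (eta / 3))) <= 1 / 2.
  rewrite expRN div1r lef_pV2 ?posrE ?expR_gt0 //.
  by apply: le_trans (expR_ge1Dx _); clear - neta; lra.
set A := window _ _ _ _ _ _.
have mA : measurable A by exact: measurable_window.
have mGD : measurable (G `&` dom_tuple V n) by apply: measurableI => //; exact: measurable_dom_tuple.
have GA : G `&` dom_tuple V n `<=` A.
  move=> y [[g1 g2 g3 g4] Dy]; split=> //.
    by apply: le_trans g1 _; rewrite ler_wpM2l.
  have := ler_wpM2l n0 h2; have := ler_wpM2l n0 h3; move: g2 g3.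
  by rewrite ler_norml; clear => *; apply/andP; split; lra.
pose k := - (n%:R * (s * u + t * v + 2 * (eta / 3))).
have Hk : (tilted_volume V s (c * t) G <= (expR (- k))%:E * lebesgue_tuple A)%E.
  rewrite (tilted_volume_dom _ _ mG mGD).
  rewrite (@lebesgue_tuple_tilted _ V) //; last by move=> y [].
  have H1 : (tilted_volume V 0 0 (G `&` dom_tuple V n) <= tilted_volume V 0 0 A)%E.
    exact: tilted_volumeS.
  apply: le_trans (lee_wpmul2l _ H1); last by rewrite lee_fin expR_ge0.
  apply: tilted_volume_change => // y [[g1 g2 g3 g4] Dy] _.
  rewrite !mul0r addr0 /k.
  have He : s * energy V y <= n%:R * (s * u + eta / 3).
    apply: le_trans (ler_wnM2l (ltW s0) g4) _.
    by rewrite mulrCA ler_wpM2l.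
  have Hq : c * t * sumsq y <= n%:R * (t * v + eta / 3).
    rewrite mulrAC [leLHS]mulrC.
    have [t0|t0] := leP 0 t.
      apply: le_trans (ler_wpM2l t0 g2) _.
      by rewrite mulrCA ler_wpM2l.
    apply: le_trans (ler_wnM2l (ltW t0) g3) _.
    by rewrite mulrCA ler_wpM2l.
  by move: He Hq; clear; lra.
have ek0 : 0 < expR (- k) by exact: expR_gt0.
rewrite -(@lee_pmul2l _ (expR (- k))%:E) ?lte_fin //.
apply: le_trans (le_trans half Hk).
rewrite -EFinM lee_fin -expRD.
have HML := HM s t s0.
have -> : Z s (c * t) ^+ n = expR (n%:R * ln (Z s (c * t))).
  by rewrite expRM_natl lnK ?posrE.
apply: le_trans (_ : expR (n%:R * ln (Z s (c * t)) + - (n%:R * (eta / 3))) <= _); last first.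
  by rewrite expRD ler_wpM2l ?expR_ge0 //; move: ee2; rewrite div1r.
rewrite ler_expR /k.
by have := ler_wpM2l n0 HML; clear; lra.
Qed.

End lower_bound_volume.

(** * Windows inside the ball, and the volume of the ball *)

Section ball_volume.
Context {R : realType} (V : R -> \bar R).
Hypotheses (V_orlicz : orlicz V) (V_superquadratic : superquadratic V).
Hypothesis V_nontrivial : exists2 a : R, 0 < a & (V a < +oo)%E.
Local Notation Z := (partition_fun V).

(** The point (1/2, c a^2) has a finite dual bound; it is the point towards which (1, v) is moved
    below, and its case c = 0 bounds [dual_sup]. *)
Lemma orlicz_dual_bound : exists2 a : R, 0 < a & forall c s t, s < 0 ->
  s / 2 + t * (c * a ^+ 2) - ln (Z s (c * t)) <= - ln a.
Proof.
have [a a0 H] := partition_ge_exp V_orlicz V_superquadratic V_nontrivial.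
exists a => // c s t s0.
have Zp : 0 < Z s (c * t) by exact: partition_gt0.
have := H s (c * t) s0; rewrite mul_expR_le_ln //; clear; lra.
Qed.

Lemma windowS n (e c v d e' c' v' d' : R) :
  window V n e c v d `<=` window V n e' c' v' d' ->
  (lebesgue_tuple (window V n e c v d) <= lebesgue_tuple (window V n e' c' v' d'))%E.
Proof.
move=> S; rewrite !(@lebesgue_tuple_tilted _ V); try by move=> y [].
by apply: tilted_volumeS => //; exact: measurable_window.
Qed.

(* Moving (1, v) slightly towards a point with energy 1/2 makes the energy
   constraint strict, at a small cost in the dual bound. *)
Lemma window_volume_ge (c v M delta eta : R) :
  0 <= c <= 1 -> 0 < delta -> 0 < eta ->
  (forall s t, s < 0 -> s + t * v - ln (Z s (c * t)) <= M) ->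
  exists N, forall n, (N <= n)%N ->
    ((expR (- (n%:R * (M + eta))))%:E <= lebesgue_tuple (window V n 1 c v delta))%E.
Proof.
move=> c01 delta0 eta0 HM.
have [a a0 Ha] := orlicz_dual_bound.
pose v0 := c * a ^+ 2; pose M0 := - ln a.
pose l := Num.min 1 (Num.min (eta / (2 * (`|M0 - M| + 1))) (delta / (2 * (`|v0 - v| + 1)))).
have p1 : 0 < `|M0 - M| + 1 by rewrite ltr_pwDr.
have p2 : 0 < `|v0 - v| + 1 by rewrite ltr_pwDr.
have l0 : 0 < l by rewrite !lt_min ltr01 !divr_gt0 ?mulr_gt0.
have l1 : l <= 1 by rewrite ge_min lexx.
have lM : l * `|M0 - M| <= eta / 2.
  apply: (@le_trans _ _ (l * (`|M0 - M| + 1))); first by rewrite ler_wpM2l ?lerDl // ltW.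
  by rewrite -ler_pdivlMr // -mulrA -invfM !ge_min lexx orbT.
have lv : l * `|v0 - v| <= delta / 2.
  apply: (@le_trans _ _ (l * (`|v0 - v| + 1))); first by rewrite ler_wpM2l ?lerDl // ltW.
  by rewrite -ler_pdivlMr // -mulrA -invfM !ge_min lexx !orbT.
(* The moved energy level is 1 - l / 2, so l / 2 is the room left for the overshoot in
   [volume_lower_bound]. *)
pose delta' := Num.min (delta / 2) (l / 2).
have d'0 : 0 < delta' by rewrite lt_min !divr_gt0.
have d'1 : delta' <= delta / 2 by rewrite ge_min lexx.
have d'2 : delta' <= l / 2 by rewrite ge_min lexx orbT.
have eta2 : 0 < eta / 2 by rewrite divr_gt0.
have [N HN] : exists N, forall n, (N <= n)%N ->
    ((expR (- (n%:R * ((M + l * (M0 - M)) + eta / 2))))%:E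
       <= lebesgue_tuple (window V n ((1 - l / 2) + delta') c (v + l * (v0 - v)) delta'))%E.
  apply: volume_lower_bound => // s t s0.
  have H1 := ler_wpM2l (ltW l0) (Ha c s t s0).
  have l1' : 0 <= 1 - l by rewrite subr_ge0.
  have := ler_wpM2l l1' (HM s t s0); move: H1; rewrite /M0 /v0; clear; lra.
exists N => n Nn; apply: le_trans (le_trans (HN n Nn) (windowS _)).
  rewrite lee_fin ler_expR lerN2 ler_wpM2l //.
  have : l * (M0 - M) <= l * `|M0 - M| by rewrite ler_wpM2l ?ler_norm // ltW.
  move: lM; clear; lra.
move=> y [Dy Ey Qy]; split=> //.
  by apply: le_trans Ey _; rewrite ler_wpM2l //; move: d'2; clear; lra.
have n0 : 0 <= n%:R :> R by [].
have -> : c * sumsq y - n%:R * v =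
  (c * sumsq y - n%:R * (v + l * (v0 - v))) + n%:R * (l * (v0 - v)) by ring.
apply: le_trans (ler_normD _ _) _.
have -> : `|n%:R * (l * (v0 - v))| = n%:R * (l * `|v0 - v|).
  by rewrite !normrM (ger0_norm n0) (ger0_norm (ltW l0)).
have := ler_wpM2l n0 lv; have := ler_wpM2l n0 d'1; move: Qy; clear; lra.
Qed.

(** By [ball_volume_le] and [ball_volume_ge], this is minus the exponential growth rate of the
    volume of the ball. *)
Definition dual_sup : \bar R :=
  ereal_sup [set s%:E - log_partition V s 0 | s in [set s : R | (s < 0)%R]]%E.

Lemma dual_sup_fin : dual_sup \is a fin_num.
Proof.
have [a a0 Ha] := orlicz_dual_bound.
rewrite fin_numE; apply/andP; split.
  rewrite -ltNye; apply: (@lt_le_trans _ _ ((-1)%:E - log_partition V (-1) 0)%E).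
    by rewrite log_partitionE // -EFinB ltNyr.
  by apply: ereal_sup_ubound; exists (-1) => //=; rewrite oppr_lt0.
rewrite -ltey; apply: (@le_lt_trans _ _ (- ln a)%:E); last exact: ltry.
apply: ge_ereal_sup => _ [s /= s0 <-].
rewrite log_partitionE // -EFinB lee_fin.
have := Ha 0 s 0 s0; rewrite !mul0r addr0; move: s0; clear; lra.
Qed.

Lemma dual_le s : s < 0 -> s - ln (Z s 0) <= fine dual_sup.
Proof.
move=> s0; rewrite -lee_fin fineK ?dual_sup_fin // EFinB -log_partitionE //.
by apply: ereal_sup_ubound; exists s.
Qed.

Lemma dual_near eta : 0 < eta ->
  exists2 s, s < 0 & fine dual_sup - eta < s - ln (Z s 0).
Proof.
move=> eta0; have [_ [s /= s0 <-]] := ub_ereal_sup_adherent eta0 dual_sup_fin.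
rewrite -/dual_sup -(fineK dual_sup_fin) log_partitionE // -!EFinB lte_fin.
by exists s.
Qed.

Lemma volume_le n (A : set (n.-tuple R)) s t w : measurable A ->
  A `<=` orlicz_ball V n -> s < 0 -> (forall y, A y -> n%:R * w <= t * sumsq y) ->
  (lebesgue_tuple A <= (expR (- (n%:R * (s + w - ln (Z s t)))))%:E)%E.
Proof.
move=> mA; rewrite (orlicz_ballE _ V_orlicz) => AB s0 Aw.
rewrite (@lebesgue_tuple_tilted _ V); last by move=> y /AB [].
have Zp : 0 < Z s t by exact: partition_gt0.
have -> : expR (- (n%:R * (s + w - ln (Z s t)))) =
    expR (- (n%:R * (s + w))) * Z s t ^+ n.
  rewrite -[X in _ * X ^+ n](lnK (x := Z s t)) ?posrE // -expRM_natl -expRD.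
  by congr expR; ring.
apply: tilted_volume_le => // y Ay _; have [_ /= Ey] := AB y Ay.
have := Aw y Ay; have := ler_wnM2l (ltW s0) Ey; clear; lra.
Qed.

Lemma ball_volume_le n s : s < 0 ->
  (lebesgue_tuple (orlicz_ball V n) <= (expR (- (n%:R * (s - ln (Z s 0)))))%:E)%E.
Proof.
move=> s0; have := @volume_le n (orlicz_ball V n) s 0 0; rewrite addr0; apply => //.
  exact: measurable_orlicz_ball.
by move=> y _; rewrite mulr0 mul0r.
Qed.

Lemma window_sub_ball n c v d : window V n 1 c v d `<=` orlicz_ball V n.
Proof.
by rewrite (orlicz_ballE _ V_orlicz) => y [Dy Ey _]; split=> //=; rewrite mulr1 in Ey.
Qed.

Lemma volumeS n (A B : set (n.-tuple R)) : measurable A -> measurable B ->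
  A `<=` B -> B `<=` orlicz_ball V n -> (lebesgue_tuple A <= lebesgue_tuple B)%E.
Proof.
move=> mA mB AB; rewrite (orlicz_ballE _ V_orlicz) => BV.
rewrite (@lebesgue_tuple_tilted _ V _ A); last by move=> y /AB /BV [].
rewrite (@lebesgue_tuple_tilted _ V _ B); last by move=> y /BV [].
exact: tilted_volumeS.
Qed.

(** At c = v = 0 the dual hypothesis of [window_volume_ge] no longer depends on t and reduces to
    [dual_le]. *)
Lemma ball_volume_ge eta : 0 < eta -> exists N, forall n, (N <= n)%N ->
  ((expR (- (n%:R * (fine dual_sup + eta))))%:E <= lebesgue_tuple (orlicz_ball V n))%E.
Proof.
move=> eta0; have [N HN] : exists N, forall n, (N <= n)%N ->
    ((expR (- (n%:R * (fine dual_sup + eta))))%:E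
       <= lebesgue_tuple (window V n 1 0 0 1))%E.
  apply: window_volume_ge => //; first by rewrite lexx ler01.
  by move=> s t s0; rewrite mulr0 addr0 mul0r; exact: dual_le.
exists N => n /HN /le_trans; apply; apply: volumeS => //.
- exact: measurable_window.
- exact: measurable_orlicz_ball.
- exact: window_sub_ball.
Qed.

End ball_volume.

(** * The rate function *)

Section nonneg_topology.
Context {R : realType}.

Lemma continuous_nonneg_val : continuous (fun z : nonneg_reals R => \val z : R).
Proof. exact: initial_continuous. Qed.

(** A continuous retraction of the line onto the subspace, used to carry compactness and continuity
    over to it. *)
Definition nonneg_abs (x : R) : nonneg_reals R := to_nonneg (normr_ge0 x).

Lemma continuous_nonneg_abs : continuous nonneg_abs.
Proof.
apply/continuousP => _ [A oA <-].
exact: (open_comp (fun x _ => @norm_continuous _ R^o x) oA).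
Qed.

Lemma nonneg_val_ge0 (z : nonneg_reals R) : 0 <= \val z.
Proof. by case: z => x /= /set_mem. Qed.

Lemma nonneg_absK (z : nonneg_reals R) : nonneg_abs (\val z) = z.
Proof. by apply/val_inj; rewrite /= ger0_norm // nonneg_val_ge0. Qed.

Lemma compact_nonneg (A : set (nonneg_reals R)) (c : R) : closed A ->
  (forall z, A z -> \val z <= c) -> compact A.
Proof.
move=> cA Ac; apply: (@subclosed_compact _ A (nonneg_abs @` `[0, c]%classic)) => //.
  apply: continuous_compact; last exact: segment_compact.
  by apply: continuous_subspaceT; exact: continuous_nonneg_abs.
move=> z Az; exists (\val z); last exact: nonneg_absK.
by rewrite /= in_itv /= nonneg_val_ge0 Ac.
Qed.

End nonneg_topology.

Section rate_function.
Context {R : realType} (V : R -> \bar R).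
Hypotheses (V_orlicz : orlicz V) (V_superquadratic : superquadratic V).
Hypothesis V_nontrivial : exists2 a : R, 0 < a & (V a < +oo)%E.
Local Notation Z := (partition_fun V).
Local Notation S := (fine (dual_sup V)).

Lemma dual_supE : dual_sup V = S%:E.
Proof. by rewrite fineK // dual_sup_fin. Qed.

Lemma rate_JXV_ge (z : nonneg_reals R) s t : s < 0 ->
  ((s + t * \val z ^+ 2 - ln (Z s t) - S)%:E <= rate_JXV V z)%E.
Proof.
move=> s0; rewrite /rate_JXV -/(dual_sup V) dual_supE EFinB leeB //.
rewrite EFinB -log_partitionE //; apply: ereal_sup_ubound.
by exists (s, t) => //=; rewrite mulr1.
Qed.

Lemma rate_JXV_gt (z : nonneg_reals R) a : (a%:E < rate_JXV V z)%E ->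
  exists s t, s < 0 /\ a + S < s + t * \val z ^+ 2 - ln (Z s t).
Proof.
rewrite /rate_JXV -/(dual_sup V) dual_supE lteBrDr // -EFinD => /ereal_sup_gt.
move=> [_ [[s t] /= s0 <-]]; rewrite log_partitionE // -EFinB lte_fin mulr1 => H.
by exists s, t.
Qed.

(** At t = 0 the terms of [calJ] are those of [dual_sup]. *)
Lemma rate_JXV_ge0 z : (0 <= rate_JXV V z)%E.
Proof.
rewrite leNgt; apply/negP => Jneg.
have [r Jr r0] : exists2 r : R, (rate_JXV V z < r%:E)%E & r < 0.
  have := rate_JXV_ge z 0 (ltrN10 R); move: Jneg; case: (rate_JXV V z) => [r| |] //.
  by rewrite !lte_fin => r0 _; exists (r / 2); rewrite ?lte_fin; lra.
have mr0 : 0 < - r by rewrite oppr_gt0.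
have [s s0 Hs] := dual_near V_orlicz V_superquadratic V_nontrivial mr0.
have := le_lt_trans (rate_JXV_ge z 0 s0) Jr.
rewrite lte_fin mul0r addr0; move: Hs; clear; lra.
Qed.

(** Kept as a subset of the line, besides its trace [exceeds], because the finite subcover is
    extracted in the line. *)
Definition exceeding (s t a : R) : set R :=
  [set x | a + S < s + t * x ^+ 2 - ln (Z s t)].

Definition exceeds (s t a : R) : set (nonneg_reals R) :=
  [set z | exceeding s t a (\val z)].

Lemma open_exceeding s t a : open (exceeding s t a).
Proof.
apply: (@open_comp _ _ (fun x : R => s + t * x ^+ 2 - ln (Z s t))
  [set y : R | a + S < y]); last exact: open_gt.
move=> x _; apply: cvgB; last exact: cvg_cst.
apply: cvgD; first exact: cvg_cst.
apply: cvgM; first exact: cvg_cst.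
exact: exprn_continuous.
Qed.

Lemma open_exceeds s t a : open (exceeds s t a).
Proof.
apply: (@open_comp _ _ (fun z : nonneg_reals R => \val z) (exceeding s t a)).
  by move=> z _; exact: continuous_nonneg_val.
exact: open_exceeding.
Qed.

Lemma rate_JXV_exceeds z a : (a%:E < rate_JXV V z)%E ->
  exists2 p : R * R, p.1 < 0 & exceeds p.1 p.2 a z.
Proof. by move=> /rate_JXV_gt [s [t [s0 H]]]; exists (s, t). Qed.

Lemma rate_JXV_lsc : lower_semicontinuous (rate_JXV V).
Proof.
move=> z a /rate_JXV_exceeds[[s t] /= s0 H]; exists (exceeds s t a).
  by apply: open_nbhs_nbhs; split => //; exact: open_exceeds.
move=> z' /= Hz'; apply: lt_le_trans (rate_JXV_ge z' t s0).
by rewrite lte_fin; move: Hz'; rewrite /exceeds /exceeding /=; clear; lra.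
Qed.

(** Since t = 1/2 is positive, the tested function grows with z. This single set plays the part of
    exponential tightness: what it leaves of a closed set is compact. *)
Lemma not_exceeds_bounded a : exists c, forall z, ~ exceeds (-1) (1 / 2) a z -> \val z <= c.
Proof.
exists (1 + 2 * `|a + S + 1 + ln (Z (-1) (1 / 2))|) => z /negP; rewrite -leNgt.
set b := a + S + 1 + ln _ => H.
have hz : \val z ^+ 2 <= 2 * `|b|.
  have := ler_norm b; rewrite {1}/b; move: H; clear; lra.
have := nonneg_val_ge0 z; have := sqr_ge0 (\val z - 1); rewrite sqrrB1.
by have := normr_ge0 b; move: hz; clear; lra.
Qed.

Lemma rate_JXV_good : good_rate_function (rate_JXV V).
Proof.
split; first by split; [exact: rate_JXV_ge0|exact: rate_JXV_lsc].
move=> a; have [c Hc] := not_exceeds_bounded a.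
apply: (compact_nonneg (c := c)).
  rewrite (_ : [set x | _] = ~` [set x | (a%:E < rate_JXV V x)%E]).
    by apply: open_closedC; move/lower_semicontinuousP : rate_JXV_lsc; exact.
  by apply/seteqP; split => x /=; rewrite leNgt => /negP.
move=> z /= Jz; apply: Hc => H.
have := le_trans (rate_JXV_ge z (1 / 2) (ltrN10 R)) Jz.
by rewrite lee_fin; move: H; rewrite /exceeds /exceeding /=; clear; lra.
Qed.

End rate_function.

(** * The large deviation principle *)

Section rescaled_limits.
Context {R : realType}.
Implicit Types (u : (\bar R)^nat) (p q : \bar R) (a b x : R).

Lemma limn_esup_le u N (l : \bar R) : (forall n, (N <= n)%N -> (u n <= l)%E) ->
  (limn_esup u <= l)%E.
Proof.
move=> ul; rewrite limn_esup_lim; apply: lime_le; first exact: is_cvg_esups.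
by exists N => // m /= Nm; apply: ge_ereal_sup => _ [k /= mk <-]; apply/ul/(leq_trans Nm).
Qed.

Lemma limn_einf_ge u N (l : \bar R) : (forall n, (N <= n)%N -> (l <= u n)%E) ->
  (l <= limn_einf u)%E.
Proof.
move=> ul; rewrite limn_einf_lim; apply: lime_ge; first exact: is_cvg_einfs.
by exists N => // m /= Nm; apply: le_ereal_inf_tmp => _ [k /= mk <-]; apply/ul/(leq_trans Nm).
Qed.

Lemma rescaled_lne_le n p x : (0 < n)%N -> (0 <= p)%E ->
  (p <= (expR (n%:R * x))%:E)%E -> ((n%:R^-1)%:E * lne p <= x%:E)%E.
Proof.
move=> n0 p0 px; have n0' : 0 < n%:R :> R by rewrite ltr0n.
have -> : x%:E = ((n%:R^-1)%:E * (n%:R * x)%:E)%E.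
  by rewrite -EFinM mulKf // lt0r_neq0.
apply: lee_wpmul2l; first by rewrite lee_fin invr_ge0 ltW.
rewrite -[leRHS](@expeRK R); rewrite lee_lne // in_itv /= ?p0 ?leey //.
by rewrite lee_fin expR_ge0.
Qed.

Lemma rescaled_lne_ge n p x : (0 < n)%N ->
  ((expR (n%:R * x))%:E <= p)%E -> (x%:E <= (n%:R^-1)%:E * lne p)%E.
Proof.
move=> n0 px; have n0' : 0 < n%:R :> R by rewrite ltr0n.
have -> : x%:E = ((n%:R^-1)%:E * (n%:R * x)%:E)%E.
  by rewrite -EFinM mulKf // lt0r_neq0.
apply: lee_wpmul2l; first by rewrite lee_fin invr_ge0 ltW.
have e0 : (0 <= (expR (n%:R * x))%:E)%E by rewrite lee_fin expR_ge0.
rewrite -[leLHS](@expeRK R); rewrite lee_lne // in_itv /= ?leey ?e0 //.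
by rewrite andbT (le_trans e0).
Qed.

Lemma ediv_le_expR p q a b : (0 <= p)%E -> (p <= (expR a)%:E)%E -> ((expR b)%:E <= q)%E ->
  (p / q <= (expR (a - b))%:E)%E.
Proof.
move=> p0 pa; case: q => [q| |] //; last by rewrite invey mule0 lee_fin expR_ge0.
rewrite lee_fin => bq; have q0 : 0 < q by apply: lt_le_trans bq; exact: expR_gt0.
rewrite inver gt_eqF // expRB EFinM.
apply: lee_pmul; rewrite ?lee_fin ?invr_ge0 ?(ltW q0) //.
by rewrite lef_pV2 // posrE // expR_gt0.
Qed.

Lemma ediv_ge_expR p q a b : ((expR a)%:E <= p)%E -> (0 <= q)%E -> (q <= (expR b)%:E)%E ->
  ((expR (a - b))%:E <= p / q)%E.
Proof.
move=> ap; case: q => [q| |] //; rewrite !lee_fin => q0 qb.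
have p0 : (0 < p)%E by apply: lt_le_trans ap; rewrite lte_fin expR_gt0.
rewrite inver; case: eqP => [_|/eqP qn0]; first by rewrite gt0_muley // leey.
have q1 : 0 < q by rewrite lt0r qn0.
rewrite expRB EFinM; apply: lee_pmul; rewrite ?lee_fin ?invr_ge0 ?expR_ge0 //.
by rewrite lef_pV2 // posrE // expR_gt0.
Qed.

Lemma measure_union_seq_le d (T : measurableType d) (P : probability T R)
    (I : eqType) (r : seq I) (B : I -> set T) (b : \bar R) :
  (0 <= b)%E -> (forall i, measurable (B i)) ->
  (forall i, i \in r -> (P (B i) <= b)%E) ->
  measurable [set x | exists2 i, i \in r & B i x] /\
  (P [set x | exists2 i, i \in r & B i x] <= (size r)%:R%:E * b)%E.
Proof.
move=> b0 mB; elim: r => [_|i r IH Hr].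
  rewrite (_ : [set _ | _] = set0) ?measure0 ?mul0e; last by apply/seteqP; split => x // [].
  by split.
have [mr Pr] := IH (fun j jr => Hr j (mem_behead (s := i :: r) jr)).
rewrite (_ : [set _ | _] = B i `|` [set x | exists2 i, i \in r & B i x]); last first.
  apply/seteqP; split => x /=.
    by move=> [j]; rewrite inE => /orP[/eqP ->|jr] Bj; [left|right; exists j].
  by move=> [Bi|[j jr Bj]]; [exists i; rewrite ?mem_head|exists j; rewrite // inE jr orbT].
split; first exact: measurableU.
apply: le_trans (measureU2 _ _ _) _ => //.
rewrite [size _]/= -[(size r).+1]add1n natrD EFinD ge0_muleDl //= mul1e.
by apply: leeD => //; apply: Hr; exact: mem_head.
Qed.

End rescaled_limits.

Section scaled_norm_theory.
Context {R : realType}.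

Lemma measurable_preimage_borel d (T : measurableType d) (f : T -> nonneg_reals R) :
  measurable_fun setT (fun x => \val (f x)) ->
  forall G, borel G -> measurable (f @^-1` G).
Proof.
move=> mf; apply: smallest_sub => [|_ [A oA <-]].
  split=> [|A|F]; first by rewrite /= preimage_set0.
    by rewrite /= setTD preimage_setC; exact: measurableC.
  by move=> mF /=; rewrite preimage_bigcup; exact: bigcupT_measurable.
rewrite -[X in measurable X]setTI; apply: mf => //.
exact: open_measurable.
Qed.

Lemma scaled_norm_sqr n (y : n.-tuple R) : (0 < n)%N ->
  n%:R * \val (scaled_norm y) ^+ 2 = sumsq y.
Proof.
move=> n0; have n0' : n%:R != 0 :> R by rewrite pnatr_eq0 -lt0n.
have sum0 : 0 <= sumsq y by apply: sumr_ge0 => i _; exact: sqr_ge0.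
rewrite /= expr_div_n !sqr_sqrtr //; first by rewrite mulrCA divff ?mulr1.
Qed.

Lemma measurable_scaled_norm n :
  measurable_fun setT (fun y : n.-tuple R => \val (scaled_norm y)).
Proof.
apply: measurable_funM => //.
apply: (@measurableT_comp _ _ _ _ _ _ (@Num.sqrt R)); last exact: measurable_sumsq.
exact: continuous_measurable_fun (@sqrt_continuous R).
Qed.

End scaled_norm_theory.

Section uniform_ball.
Context {R : realType} (V : R -> \bar R).
Hypotheses (V_orlicz : orlicz V) (V_superquadratic : superquadratic V).
Local Notation mu := (@lebesgue_measure R).

(** The function that is 0 at 0 and infinite elsewhere is also a superquadratic Orlicz function. It
    is excluded because its ball in dimension 1 has volume 0 and so carries no uniform law. *)
Lemma uniform_nontrivial d (Omega : measurableType d) (P : probability Omega R)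
    (X : Omega -> 1.-tuple R) : uniform_on P (orlicz_ball V 1) X ->
  exists2 a : R, 0 < a & (V a < +oo)%E.
Proof.
move=> XU; apply: contrapT => triv.
have V0 x : (V x < +oo)%E -> x = 0.
  case: V_orlicz => _ _ _ sym Vx; apply: contrapT => /eqP; rewrite neq_lt => /orP[x0|x0].
    by apply: triv; exists (- x); rewrite ?oppr_gt0 // -sym.
  by apply: triv; exists x.
have tilt0 : (\int[mu]_x (tilt V 0 0 x)%:E = 0%:E)%E.
  apply/eqP; rewrite eq_le integral_ge0 ?andbT; last first.
    by move=> x _; rewrite lee_fin tilt_ge0.
  apply: (@le_trans _ _ (\int[mu]_x (\1_[set (0 : R)] x)%:E)%E); last first.
    rewrite integral_indic // setIT le_eqVlt; apply/orP; left; apply/eqP.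
    exact: lebesgue_measure_set1.
  apply: ge0_le_integral => //.
  - by move=> x _; rewrite lee_fin tilt_ge0.
  - exact: measurable_EFin_tilt.
  - by apply: measurableT_comp => //; exact: measurable_indic.
  move=> x _; rewrite lee_fin /tilt indicE; case: ifP => // Vx.
  by rewrite (V0 _ Vx) !mul0r addr0 expR0 mem_set.
have ball0 : lebesgue_tuple (orlicz_ball V 1) = 0%E.
  have mB : measurable (orlicz_ball V 1) by exact: measurable_orlicz_ball.
  apply/eqP; rewrite eq_le lebesgue_tupleE tuple_integral_ge0 ?andbT //.
  rewrite -lebesgue_tupleE (@lebesgue_tuple_tilted _ V); last first.
    by rewrite (orlicz_ballE _ V_orlicz) => y [].
  apply: le_trans (tilted_volumeS V_orlicz 0 0 mB measurableT (@subsetT _ _)) _.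
  rewrite /tilted_volume; under eq_tuple_integral do rewrite indicT mulr1.
  rewrite (tuple_integral_prod 1 (measurable_tilt V_orlicz 0 0) (tilt_ge0 V 0 0) tilt0).
  by rewrite expr1.
have := XU setT measurableT.
by rewrite preimage_setT probability_setT setTI ball0 mul0e => /eqP; rewrite onee_eq0.
Qed.

End uniform_ball.

(** * Upper and lower large deviation bounds *)

Section large_deviations.
Context {R : realType} (V : R -> \bar R).
Hypotheses (V_orlicz : orlicz V) (V_superquadratic : superquadratic V).
Context (d : nat -> measure_display) (Omega : forall n, measurableType (d n))
  (P : forall n, probability (Omega n) R)
  (X : forall n, {mfun Omega n >-> n.-tuple R}).
Hypothesis X_uniform : forall n, (0 < n)%N -> uniform_on (P n) (orlicz_ball V n) (X n).
Local Notation Z := (partition_fun V).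
Local Notation S := (fine (dual_sup V)).
Local Notation eta n := (fun omega => scaled_norm (X n omega)).
Local Notation V_nontrivial := (uniform_nontrivial V_orlicz (X_uniform (ltn0Sn 0))).

Lemma measurable_scaled_norm_preimage n (G : set (nonneg_reals R)) : borel G ->
  measurable (@scaled_norm R n @^-1` G).
Proof. by apply: measurable_preimage_borel; exact: measurable_scaled_norm. Qed.

Lemma measurable_eta n (G : set (nonneg_reals R)) : borel G ->
  measurable (eta n @^-1` G).
Proof.
move=> bG; have mA := measurable_scaled_norm_preimage (n := n) bG.
by have := @measurable_funPT _ _ _ _ (X n) measurableT _ mA; rewrite setTI.
Qed.

Lemma prob_etaE n (G : set (nonneg_reals R)) : (0 < n)%N -> borel G ->
  P n (eta n @^-1` G) = (lebesgue_tuple ((@scaled_norm R n @^-1` G) `&` orlicz_ball V n)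
    / lebesgue_tuple (orlicz_ball V n))%E.
Proof. by move=> n0 bG; apply: X_uniform => //; exact: measurable_scaled_norm_preimage. Qed.

Lemma borel_open (G : set (nonneg_reals R)) : open G -> borel G.
Proof. by move=> oG; apply: sub_sigma_algebra. Qed.

Lemma prob_exceeds_le s t a e : s < 0 -> 0 < e -> exists N, forall n, (N <= n)%N ->
  (P n (eta n @^-1` exceeds V s t a) <= (expR (n%:R * - (a - e)))%:E)%E.
Proof.
move=> s0 e0; have [N HN] := ball_volume_ge V_orlicz V_superquadratic V_nontrivial e0.
exists (maxn N 1) => n; rewrite geq_max => /andP[/HN ballge n0].
have bE : borel (exceeds V s t a) by apply: borel_open; exact: open_exceeds.
rewrite prob_etaE //.
have -> : n%:R * - (a - e) = - (n%:R * (a + S)) - - (n%:R * (S + e)) by ring.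
apply: ediv_le_expR => //; first by rewrite lebesgue_tupleE tuple_integral_ge0.
pose w := a + S - s + ln (Z s t).
have -> : a + S = s + w - ln (Z s t) by rewrite /w; ring.
apply: volume_le => //; first exact: V_nontrivial.
- apply: measurableI; last exact: measurable_orlicz_ball.
  exact: measurable_scaled_norm_preimage.
move=> y [yE _]; rewrite -(scaled_norm_sqr y n0) mulrCA ler_wpM2l //.
by move: yE; rewrite /exceeds /exceeding /= /w; lra.
Qed.

Lemma ldp_upper (G : set (nonneg_reals R)) a e : borel G -> 0 < e ->
  (forall z, closure G z -> (a%:E < rate_JXV V z)%E) ->
  (limn_esup (fun n => ((n%:R)^-1)%:E * lne (P n (eta n @^-1` G))) <= (- (a - e))%:E)%E.
Proof.
move=> bG e0 HG.
pose f (p : R * R) := exceeds V p.1 p.2 a.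
have of' p : open (f p) by exact: open_exceeds.
have [c Hc] := not_exceeds_bounded V a.
have cK : compact (closure G `&` ~` f (-1, 1 / 2)).
  apply: (@compact_nonneg _ _ c); last by move=> z [_]; exact: Hc.
  by apply: closedI; [exact: closed_closure|exact: open_closedC].
have {cK} := continuous_compact
  (continuous_subspaceT (@continuous_nonneg_val R)) cK.
rewrite compact_cover => /(_ _ [set p : R * R | p.1 < 0]
  (fun p => exceeding V p.1 p.2 a)) [||D' D'D covK].
- by move=> p _; exact: open_exceeding.
- move=> _ [z [/HG Jz _] <-].
  have [p p0 pz] := rate_JXV_exceeds V_orlicz V_superquadratic V_nontrivial Jz.
  by exists p.
(* The added pair covers the unbounded part of the closure, the finite subcover the compact rest. *)
pose r : seq (R * R) := (-1, 1 / 2) :: finmap.enum_fset D'.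
have r0 p : p \in r -> p.1 < 0.
  rewrite inE => /orP[/eqP -> /=|/D'D]; first by rewrite oppr_lt0.
  by rewrite inE.
have Gr z : G z -> exists2 p, p \in r & f p z.
  move=> Gz; have [fz|nfz] := pselect (f (-1, 1 / 2) z).
    by exists (-1, 1 / 2); rewrite ?mem_head.
  have [|p pD' pz] := covK (\val z).
    by exists z => //; split => //; exact: subset_closure.
  by exists p; [rewrite inE; apply/orP; right|exact: pz].
have e2 : 0 < e / 2 by rewrite divr_gt0.
have /choice[Nf HNf] : forall p : R * R, exists N, p.1 < 0 -> forall n, (N <= n)%N ->
    (P n (eta n @^-1` f p) <= (expR (n%:R * - (a - e / 2)))%:E)%E.
  move=> p; have [p0|p0] := boolP (p.1 < 0); last by exists 0%N.
  by have [N HN] := prob_exceeds_le p.2 a p0 e2; exists N.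
have [N1 HN1] := eventually_le_natmul (size r)%:R e2.
pose N := maxn 1 (maxn N1 (\max_(p <- r) Nf p)).
apply: (@limn_esup_le _ _ N) => n.
rewrite /N !geq_max => /and3P[n0 /HN1 size_le Nfn].
apply: rescaled_lne_le => //.
have [|||mU PU] := measure_union_seq_le (P := P n) (r := r)
   (B := fun p => eta n @^-1` f p) (b := (expR (n%:R * - (a - e / 2)))%:E).
- by rewrite lee_fin expR_ge0.
- by move=> p; apply: measurable_eta; exact: borel_open.
- move=> p pr; apply: HNf; first exact: r0.
  apply: leq_trans Nfn; exact: leq_bigmax_seq.
apply: (@le_trans _ _ (P n [set x | exists2 p, p \in r & (eta n @^-1` f p) x])).
  apply: le_measure; rewrite ?inE //; first exact: measurable_eta.
  by move=> x /= /Gr.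
apply: le_trans PU _.
rewrite -EFinM lee_fin.
(* The number of sets is at most n e / 2, hence at most e^(n e / 2). *)
have -> : n%:R * - (a - e) = n%:R * (e / 2) + n%:R * - (a - e / 2) by field.
rewrite expRD ler_wpM2r ?expR_ge0 //.
by apply: le_trans size_le (le_trans _ (expR_ge1Dx _)); rewrite lerDr.
Qed.

(** Windows control the squared norm; continuity of the square root yields a neighbourhood measured
    by squares. *)
Lemma interior_sqr_window (G : set (nonneg_reals R)) z : interior G z ->
  exists2 e, 0 < e & forall z' : nonneg_reals R, `|\val z' ^+ 2 - \val z ^+ 2| <= e -> G z'.
Proof.
move=> Gz; have cs : continuous (fun x : R => nonneg_abs (Num.sqrt x)).
  by move=> x; apply: continuous_comp; [exact: sqrt_continuous|exact: continuous_nonneg_abs].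
have sqK (w : nonneg_reals R) : nonneg_abs (Num.sqrt (\val w ^+ 2)) = w.
  by rewrite sqrtr_sqr ger0_norm ?nonneg_val_ge0 // nonneg_absK.
have Gn : nbhs (nonneg_abs (Num.sqrt (\val z ^+ 2))) G by rewrite sqK.
have /nbhs_ballP[e /= e0 He] := cs (\val z ^+ 2) _ Gn.
exists (e / 2); first by rewrite divr_gt0.
move=> z' Hz'; rewrite -(sqK z'); apply: He; rewrite /ball /= distrC.
by apply: le_lt_trans Hz' _; rewrite ltr_pdivrMr // ltr_pMr // ltr1n.
Qed.

Lemma ldp_lower (G : set (nonneg_reals R)) z : borel G -> interior G z ->
  (- rate_JXV V z <= limn_einf (fun n => ((n%:R)^-1)%:E * lne (P n (eta n @^-1` G))))%E.
Proof.
move=> bG Gz; have Vn := V_nontrivial.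
have J0 := rate_JXV_ge0 V_orlicz V_superquadratic Vn z.
case JE : (rate_JXV V z) => [j| |]; last 2 first.
- by rewrite leNye.
- by rewrite JE in J0.
apply/lee_subgt0Pr => e e0; rewrite -EFinN -EFinB.
(* One half is lost in the window volume, the other in choosing s for the upper bound on the ball
   volume. *)
have e2 : 0 < e / 2 by rewrite divr_gt0.
have [w w0 Hw] := interior_sqr_window Gz.
have [s s0 Hs] := dual_near V_orlicz V_superquadratic Vn e2.
have [N HN] : exists N, forall n, (N <= n)%N ->
    ((expR (- (n%:R * (j + S + e / 2))))%:E
       <= lebesgue_tuple (window V n 1 1 (\val z ^+ 2) w))%E.
  apply: window_volume_ge => //; first by rewrite ler01 lexx.
  move=> s' t s'0; have := rate_JXV_ge V_orlicz V_superquadratic Vn z t s'0.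
  by rewrite JE lee_fin mul1r lerBlDr.
apply: (@limn_einf_ge _ _ (maxn N 1)) => n; rewrite geq_max => /andP[/HN Wn n0].
apply: rescaled_lne_ge => //; rewrite prob_etaE //.
have mball : measurable (orlicz_ball V n) by exact: measurable_orlicz_ball.
have ball0 : (0 <= lebesgue_tuple (orlicz_ball V n))%E.
  by rewrite lebesgue_tupleE tuple_integral_ge0.
have n0' : 0 < n%:R :> R by rewrite ltr0n.
apply: le_trans (ediv_ge_expR (a := - (n%:R * (j + S + e / 2)))
  (b := - (n%:R * (s - ln (Z s 0)))) _ ball0 _).
- rewrite lee_fin ler_expR.
  have := ler_wpM2l (ltW n0') (ltW Hs); lra.
- apply: le_trans Wn _; apply: (volumeS V_orlicz) => //.
  + exact: measurable_window.
  + apply: measurableI => //; exact: measurable_scaled_norm_preimage.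
  + move=> y yW; split; last exact: window_sub_ball yW.
    apply: Hw; case: yW => _ _; rewrite mul1r -(scaled_norm_sqr y n0) -mulrBr normrM.
    by rewrite (ger0_norm (ltW n0')) ler_pM2l.
- exact: ball_volume_le.
Qed.

Lemma ldp_JXV : ldp P (fun n omega => scaled_norm (X n omega)) (fun n => n%:R)
  (rate_JXV V).
Proof.
have Vn := V_nontrivial.
split.
- by split; [exact: rate_JXV_ge0|exact: rate_JXV_lsc].
- by move=> n G; exact: measurable_eta.
move=> G bG; split; last 1 first.
- set I := ereal_inf _; set L := limn_esup _.
  have upper a e : (a%:E < I)%E -> 0 < e -> (L <= (- (a - e))%:E)%E.
    move=> aI e0; apply: ldp_upper => // z zG; apply: lt_le_trans aI _.
    by apply: ereal_inf_lbound; exists z.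
  have I0 : (0 <= I)%E by apply: le_ereal_inf_tmp => _ [z _ <-]; exact: rate_JXV_ge0.
  case IE : I I0 => [i| |] // _.
    apply/lee_addgt0Pr => e e0; have e2 : 0 < e / 2 by rewrite divr_gt0.
    have -> : (- i%:E + e%:E = (- ((i - e / 2) - e / 2))%:E)%E.
      by rewrite -EFinN -EFinD; congr _%:E; field.
    by apply: upper => //; rewrite IE lte_fin ltrBlDr ltrDl.
  have LA A : (L <= A%:E)%E.
    have -> : A = - ((1 - A) - 1) by ring.
    by apply: upper; rewrite ?IE ?ltry.
  move: LA; clear; case: L => [l| |] LA //; last by have := LA 0.
  by have := LA (l - 1); rewrite lee_fin lerDl oppr_ge0 ler10.
- rewrite leeNl; apply: le_ereal_inf_tmp => _ [z zG <-].
  by rewrite leeNl; exact: ldp_lower.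
- exact: limn_einf_sup.
Qed.

End large_deviations.

Local Open Scope ereal_scope.

(** * Gibbs measures *)

Section density.
Context d (T : measurableType d) (R : realType) (mu : {measure set T -> \bar R}).
Variable w : T -> R.

(* The two proofs are arguments so that the measure structure can be inferred. *)
Definition density_measure of measurable_fun setT w & (forall x, (0 <= w x)%R) :=
  fun A : set T => \int[mu]_(x in A) (w x)%:E.

Hypotheses (mw : measurable_fun setT w) (w0 : forall x, (0 <= w x)%R).
Local Notation density := (density_measure mw w0).

Let mwE : measurable_fun setT (fun x => (w x)%:E).
Proof. exact: measurableT_comp. Qed.

Let density0 : density set0 = 0.
Proof. by rewrite /density_measure integral_set0. Qed.

Let density_ge0 A : 0 <= density A.
Proof. by apply: integral_ge0 => x _; rewrite lee_fin. Qed.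

Let density_sigma_additive : semi_sigma_additive density.
Proof.
move=> /= F mF tF mUF; rewrite /density_measure; apply: cvg_toP.
  apply: ereal_nondecreasing_is_cvgn => m n mn.
  apply: lee_sum_nneg_natr => // k _ _.
  exact: density_ge0.
rewrite ge0_integral_bigcup //=; first exact: measurable_funTS.
by move=> x _; rewrite lee_fin.
Qed.

HB.instance Definition _ := isMeasure.Build _ _ _ (density_measure mw w0)
  density0 density_ge0 density_sigma_additive.

Import HBNNSimple.

Let integral_density_nnsfun (f : {nnsfun T >-> R}) :
  \int[density]_x (f x)%:E = \int[mu]_x ((f x)%:E * (w x)%:E).
Proof.
under [LHS]eq_integral do rewrite fimfunE -fsumEFin //.
rewrite [LHS]ge0_integral_fsum //; last 2 first.
  - by move=> r; exact/measurable_EFinP/measurableT_comp.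
  - by move=> n x _; rewrite EFinM nnfun_muleindic_ge0.
under [RHS]eq_integral.
  move=> x xD; rewrite fimfunE -fsumEFin // muleC ge0_mule_fsumr; last first.
    by move=> r; rewrite EFinM nnfun_muleindic_ge0.
  over.
rewrite [RHS]ge0_integral_fsum //; last 2 first.
  - move=> r; apply: emeasurable_funM => //.
    by apply/measurable_EFinP/measurableT_comp.
  - move=> n x _; apply: mule_ge0; first by rewrite lee_fin.
    by rewrite EFinM nnfun_muleindic_ge0.
apply: eq_fsbigr => r _.
rewrite integralZl_indic_nnsfun // integral_indic // setIT.
have mfr : measurable (f @^-1` [set r]) by [].
have [r0|r0] := ltP r 0%R.
  rewrite preimage_nnfun0 // measure0 mule0.
  by rewrite integral0_eq // => x _; rewrite indic0 mulr0 mule0.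
have E x : (w x)%:E * (r * \1_(f @^-1` [set r]) x)%:E =
    r%:E * ((w x)%:E * (\1_(f @^-1` [set r]) x)%:E).
  by rewrite EFinM muleCA.
under [RHS]eq_integral do rewrite E.
rewrite ge0_integralZl_EFin //; last 2 first.
- by move=> x _; rewrite mule_ge0 ?lee_fin.
- by apply: emeasurable_funM => //; exact/measurable_EFinP/measurable_indic.
congr (_ * _); rewrite /density_measure [LHS]integral_mkcond.
apply: eq_integral => x _; rewrite patchE indicE.
by case: ifPn => _; rewrite ?mule1 ?mule0.
Qed.

Lemma integral_density (f : T -> \bar R) : measurable_fun setT f ->
  (forall x, 0 <= f x) ->
  \int[density]_x f x = \int[mu]_x (f x * (w x)%:E).
Proof.
move=> mf f0; pose f_ := nnsfun_approx measurableT mf.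
have cvgf x : (f_ n x)%:E @[n --> \oo] --> f x by exact: cvg_nnsfun_approx.
have ndf x : {homo (fun n => (f_ n x)%:E) : a b / (a <= b)%N >-> a <= b}.
  by move=> a b ab; rewrite lee_fin; exact/lefP/nd_nnsfun_approx.
transitivity (limn (fun n => \int[density]_x (f_ n x)%:E)).
  rewrite -monotone_convergence //=.
  - by apply: eq_integral => x _; apply/esym/cvg_lim.
  - by move=> n; exact/measurable_EFinP.
  - by move=> n x _; rewrite lee_fin.
under eq_fun do rewrite integral_density_nnsfun.
rewrite -monotone_convergence //=.
- apply: eq_integral => x _; apply/cvg_lim => //.
  by apply: cvgeZr.
- by move=> n; apply: emeasurable_funM => //; exact/measurable_EFinP.
- by move=> n x _; rewrite mule_ge0 ?lee_fin.
- by move=> x _ a b ab; apply: lee_wpmul2r; rewrite ?lee_fin //; have := ndf x a b ab.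
Qed.

End density.

Local Open Scope ring_scope.

(** * Moments of Gibbs measures and the tangent inequality *)

Section gibbs_theory.
Context {R : realType} (V : R -> \bar R).
Hypotheses (V_orlicz : orlicz V) (V_superquadratic : superquadratic V).
Hypothesis V_nontrivial : exists2 a : R, 0 < a & (V a < +oo)%E.
Local Notation mu := (@lebesgue_measure R).
Local Notation Z := (partition_fun V).
Local Notation w b := (tilt V (- b) 0).

Lemma gibbs_weightE b (A : set R) :
  (\int[mu]_(x in A `&` orlicz_dom V) expeR ((- b)%:E * V x) =
   \int[mu]_(x in A) (w b x)%:E)%E.
Proof.
rewrite [LHS]integral_mkcond [RHS]integral_mkcond.
apply: eq_integral => x _; rewrite !patchE in_setI /tilt.
have -> : (x \in orlicz_dom V) = (V x < +oo)%E.
  by apply/idP/idP => [/set_mem //|?]; exact/mem_set.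
case: (x \in A) => //=; case: ifP => // Vx.
by rewrite -(orlicz_fin V_orlicz Vx) -EFinM /= mul0r addr0.
Qed.

(** [gibbs] is a bare set function; the integral is computed by identifying it with a scaled measure
    with density. *)
Lemma gibbs_integral b (h : R -> \bar R) : 0 < b -> measurable_fun setT h ->
  (forall x, 0 <= h x)%E ->
  (\int[gibbs V b]_x h x = ((Z (- b) 0)^-1)%:E * \int[mu]_x (h x * (w b x)%:E))%E.
Proof.
move=> b0 mh h0.
have nb0 : - b < 0 by rewrite oppr_lt0.
have Zp : 0 < Z (- b) 0 by exact: partition_gt0.
have k0 : 0 <= (Z (- b) 0)^-1 by rewrite invr_ge0 ltW.
have mt : measurable_fun setT (w b) by exact: measurable_tilt.
have t0 x : 0 <= w b x by exact: tilt_ge0.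
pose m := mscale (NngNum k0) (density_measure mu mt t0).
(* The library measures R and measurableTypeR R share their sigma-algebra but not
   their display, hence the push-forward along the identity. *)
pose phi (x : measurableTypeR R) : R := x.
have mphi : measurable_fun setT phi by move=> _ Y mY; rewrite setTI.
have -> : gibbs V b = pushforward m phi.
  apply/funext => A; rewrite /pushforward /m /mscale /gibbs gibbs_weightE.
  have -> : (\int[mu]_(x in orlicz_dom V) expeR ((- b)%:E * V x) = (Z (- b) 0)%:E)%E.
    by rewrite -[orlicz_dom V]setTI gibbs_weightE partitionE.
  by rewrite inver gt_eqF // muleC.
have E0 := ge0_integral_pushforward mphi m measurableT mh (fun x _ => h0 x).
apply: (etrans E0).
have E := ge0_integral_mscale (density_measure mu mt t0) measurableT (NngNum k0)
  mh (fun x _ => h0 x).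
by apply: (etrans E); congr (_ * _)%E; exact: integral_density.
Qed.

(** By 1 + y <= e^y, v e^(- b v) <= (2 / b) e^(- b v / 2), so a weaker tilt dominates. *)
Lemma integrable_energy b : 0 < b ->
  mu.-integrable setT (EFin \o (fun x => fine (V x) * w b x)).
Proof.
move=> b0; pose g (x : R) : \bar R := ((2 / b)%:E * (w (b / 2) x)%:E)%E.
have b2 : 0 < b / 2 by rewrite divr_gt0.
apply: (@le_integrable _ _ _ mu setT measurableT _ g).
- apply/measurable_EFinP; apply: measurable_funM; last exact: measurable_tilt.
  exact: measurable_fine_orlicz.
- move=> x _; have v0 := fine_orlicz_ge0 V_orlicz x.
  rewrite lee_fin ger0_norm ?mulr_ge0 ?tilt_ge0 // ger0_norm; last first.
    by rewrite mulr_ge0 ?tilt_ge0 // divr_ge0 // ltW.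
  rewrite /tilt; case: ifP => // Vx; last by rewrite !mulr0.
  rewrite !mul0r !addr0.
  have -> : - b * fine (V x) = - (b / 2) * fine (V x) + - (b / 2 * fine (V x)) by field.
  rewrite expRD mulrCA [leRHS]mulrC; apply: ler_wpM2l; first exact: expR_ge0.
  rewrite expRN ler_pdivrMr ?expR_gt0 //.
  rewrite -ler_pdivrMl ?divr_gt0 // invf_div mulrC.
  have := expR_ge1Dx (b / 2 * fine (V x)); rewrite [fine _ * _]mulrC; lra.
- by apply: integrableZl => //; apply: integrable_tilt; rewrite // oppr_lt0.
Qed.

(** Since x^2 <= e^(x^2), the tilt with t = 1 dominates. *)
Lemma integrable_sq b : 0 < b ->
  mu.-integrable setT (EFin \o (fun x => x ^+ 2 * w b x)).
Proof.
move=> b0.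
have nb0 : - b < 0 by rewrite oppr_lt0.
apply: (@le_integrable _ _ _ mu setT measurableT _ (EFin \o tilt V (- b) 1)).
- apply/measurable_EFinP; apply: measurable_funM; last exact: measurable_tilt.
  exact: measurable_funX.
- move=> x _ /=; have x0 := sqr_ge0 x.
  rewrite lee_fin (ger0_norm (tilt_ge0 V (- b) 1 x)).
  rewrite (ger0_norm (mulr_ge0 x0 (tilt_ge0 V (- b) 0 x))).
  rewrite /tilt; case: ifP => // Vx; last by rewrite mulr0.
  rewrite mul0r addr0 mul1r expRD mulrC ler_wpM2l ?expR_ge0 //.
  have := expR_ge1Dx (x ^+ 2); lra.
- exact: integrable_tilt.
Qed.

(** Unnormalised, so that the condition that V has mean 1 becomes [mean_energy b = Z (- b) 0]. *)
Definition mean_energy b := \int[mu]_x (fine (V x) * w b x).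
Definition mean_sq b := \int[mu]_x (x ^+ 2 * w b x).

Lemma partition_RE b : 0 < b -> Z (- b) 0 = \int[mu]_x w b x.
Proof. by []. Qed.

Lemma moment_VE b : 0 < b -> moment_V V (gibbs V b) = (mean_energy b / Z (- b) 0)%:E.
Proof.
move=> b0; rewrite /moment_V gibbs_integral //; last 2 first.
- exact: measurable_orlicz.
- exact: orlicz_ge0.
rewrite mulrC EFinM; congr (_ * _)%E; rewrite /mean_energy /Rintegral fineK.
  apply: eq_integral => x _; rewrite /tilt; case: ifP => Vx.
    by rewrite -[in LHS](orlicz_fin V_orlicz Vx).
  by rewrite mule0 mulr0.
exact: integrable_fin_num (integrable_energy b0).
Qed.

Lemma moment_2E b : 0 < b -> moment_2 (gibbs V b) = (mean_sq b / Z (- b) 0)%:E.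
Proof.
move=> b0; rewrite /moment_2 gibbs_integral //; last 2 first.
- by apply: measurableT_comp => //; exact: measurable_funX.
- by move=> x; rewrite lee_fin sqr_ge0.
rewrite mulrC EFinM; congr (_ * _)%E; rewrite /mean_sq /Rintegral fineK //.
exact: integrable_fin_num (integrable_sq b0).
Qed.

(* The tangent inequality exp y >= exp a (1 + y - a), integrated against the Gibbs
   weight, with a chosen so that the linear term vanishes. *)
Lemma partition_tangent b s t : 0 < b -> s < 0 -> mean_energy b = Z (- b) 0 ->
  Z (- b) 0 * expR (s + b + t * (mean_sq b / Z (- b) 0)) <= Z s t.
Proof.
move=> b0 s0 mean1; set z := Z (- b) 0; set q := mean_sq b / z.
have nb0 : - b < 0 by rewrite oppr_lt0.
have zp : 0 < z by exact: partition_gt0.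
pose a := s + b + t * q.
have iw : mu.-integrable setT (EFin \o w b) by exact: integrable_tilt.
have iE := integrable_energy b0.
have iQ := integrable_sq b0.
pose lin (x : R) := (expR a * (1 - a)) * w b x +
  ((expR a * (s + b)) * (fine (V x) * w b x) + (expR a * t) * (x ^+ 2 * w b x)).
have iZ (k : R) f : mu.-integrable setT (EFin \o f) ->
    mu.-integrable setT (EFin \o (fun x => k * f x)).
  by move=> fi; have := integrableZl measurableT k fi; apply: eq_integrable.
have iD f g : mu.-integrable setT (EFin \o f) -> mu.-integrable setT (EFin \o g) ->
    mu.-integrable setT (EFin \o (fun x => f x + g x)).
  by move=> fi gi; have := integrableD measurableT fi gi; apply: eq_integrable.
have i1 := iZ (expR a * (1 - a)) _ iw.
have i2 := iZ (expR a * (s + b)) _ iE; have i3 := iZ (expR a * t) _ iQ.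
have i23 := iD _ _ i2 i3; have i123 := iD _ _ i1 i23.
have : \int[mu]_x lin x <= \int[mu]_x tilt V s t x.
  apply: le_Rintegral => //.
  - exact: integrable_tilt.
  move=> x _; rewrite /lin /tilt; case: ifP => Vx; last by rewrite !mulr0 !addr0.
  set v := fine (V x); rewrite mul0r addr0.
  have -> : s * v + t * x ^+ 2 = - b * v + (a + ((s + b) * v + t * x ^+ 2 - a)) by ring.
  rewrite (expRD (- b * v)) (expRD a).
  have -> : expR a * (1 - a) * expR (- b * v) + (expR a * (s + b) * (v * expR (- b * v))
     + expR a * t * (x ^+ 2 * expR (- b * v))) =
     expR (- b * v) * (expR a * (1 + ((s + b) * v + t * x ^+ 2 - a))) by ring.
  by rewrite !ler_wpM2l ?expR_ge0 // expR_ge1Dx.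
rewrite /lin (RintegralD measurableT i1 i23) (RintegralD measurableT i2 i3).
rewrite (RintegralZl _ measurableT iw) (RintegralZl _ measurableT iE).
rewrite (RintegralZl _ measurableT iQ).
rewrite -/(mean_energy b) -/(mean_sq b) mean1 -(partition_RE b0) -/z.
have -> : mean_sq b = q * z by rewrite /q divfK // gt_eqF.
have -> : expR a * (1 - a) * z + (expR a * (s + b) * z + expR a * t * (q * z)) = z * expR a.
  by rewrite /a; ring.
by [].
Qed.

End gibbs_theory.

(** * The minimizer *)

(** The second-difference bound forbids a kink at 0: adding the first support line at l and the
    second at - l gives l z (p1 - p2) <= l^2 C, which fails for small l if p2 < p1. *)
Lemma slope_le (R : realType) (f : R -> R) (z C p1 p2 : R) :
  0 < z -> 0 < C ->
  (forall l, 0 < l -> l <= 1 -> f l + f (- l) <= 2 * z + l ^+ 2 * C) ->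
  (forall t, z * (1 + t * p1) <= f t) -> (forall t, z * (1 + t * p2) <= f t) ->
  p1 <= p2.
Proof.
move=> zp C0 HD H1 H2; rewrite leNgt; apply/negP => p12.
have D0 : 0 < (p1 - p2) * z by rewrite mulr_gt0 // subr_gt0.
pose l := Num.min 1 ((p1 - p2) * z / (2 * C)).
have C20 : 0 < 2 * C by rewrite mulr_gt0.
have l0 : 0 < l by rewrite lt_min ltr01 divr_gt0.
have l1 : l <= 1 by rewrite ge_min lexx.
have lC : l * (2 * C) <= (p1 - p2) * z by rewrite -(ler_pdivlMr _ _ C20) ge_min lexx orbT.
have H3 : l * ((p1 - p2) * z) <= l * (l * C).
  have := H1 l; have := H2 (- l); have := HD l l0 l1; rewrite expr2; clear; lra.
have H4 : (p1 - p2) * z <= l * C by rewrite -(ler_pM2l l0).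
by move: H4 lC D0; clear; lra.
Qed.

(** The gap is smallest at y = 1/2. It is used with y = 1 - V where V <= 1/2, to make a decrease
    quantitative. *)
Lemma mul_expR_gap (R : realType) (b b' y : R) : 0 < b -> b <= b' -> 1 / 2 <= y ->
  (expR (b' / 2) - expR (b / 2)) / 2 <= y * expR (b' * y) - y * expR (b * y).
Proof.
move=> b0 bb' y2; have y0 : 0 <= y by apply: le_trans y2; rewrite divr_ge0.
have E1 : expR (b' / 2) - expR (b / 2) <= expR (b' * y) - expR (b * y).
  have -> : b' / 2 = b / 2 + (b' - b) / 2 by field.
  have -> : b' * y = b * y + (b' - b) * y by ring.
  have d0 : 0 <= b' - b by rewrite subr_ge0.
  rewrite !expRD.
  have e1 : expR (b / 2) <= expR (b * y) by rewrite ler_expR ler_pM2l // -div1r.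
  have e2 : expR ((b' - b) / 2) - 1 <= expR ((b' - b) * y) - 1.
    by rewrite lerD2r ler_expR ler_wpM2l // -div1r.
  have e3 : 0 <= expR ((b' - b) / 2) - 1 by rewrite subr_ge0 -expR0 ler_expR divr_ge0.
  by have := ler_pM (expR_ge0 _) e3 e1 e2; clear; lra.
have E0 : 0 <= expR (b' / 2) - expR (b / 2) by rewrite subr_ge0 ler_expR ler_wpM2r.
have h0 : (0 : R) <= 1 / 2 by rewrite divr_ge0.
by have := ler_pM h0 E0 y2 E1; clear; lra.
Qed.

Lemma exists_zero_of_decay (R : realType) (psi : R -> R) (a b1 : R) :
  0 < a -> 0 < b1 -> 0 < psi b1 ->
  (forall b b', 0 < b -> b <= b' ->
    psi b' + a * (expR (b' / 2) - expR (b / 2)) <= psi b) ->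
  (forall u v, 0 < u -> {in `]u, v[%classic, continuous psi}) ->
  exists2 b, 0 < b & psi b = 0.
Proof.
move=> a0 b10 psi1 Hd cpsi.
(* By e^x >= 1 + x this is large enough for the decay from [b1] to [b2] to exceed psi(b1). *)
pose b2 := b1 + 2 * (psi b1 / a + expR (b1 / 2)).
have q0 : 0 < psi b1 / a by rewrite divr_gt0.
have b12 : b1 <= b2.
  by rewrite lerDl mulr_ge0 // addr_ge0 ?expR_ge0 // ltW.
have psi2 : psi b2 <= 0.
  have := Hd b1 b2 b10 b12.
  have : a * (psi b1 / a) <= a * (expR (b2 / 2) - expR (b1 / 2)).
    rewrite ler_pM2l //; have := expR_ge1Dx (b2 / 2).
    by rewrite /b2; move: b10; clear; lra.
  by rewrite mulrCA divff ?gt_eqF // mulr1; clear; lra.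
have [b] : exists2 b, b \in `[b1, b2] & psi b = 0.
  apply: IVT => //; last first.
    by rewrite ge_min psi2 orbT le_max (ltW psi1).
  apply: continuous_in_subspaceT => x; rewrite inE /= in_itv /= => /andP[x1 x2].
  apply: (cpsi (b1 / 2) (b2 + 1)); first by rewrite divr_gt0.
  by rewrite inE /= in_itv /=; apply/andP; split; move: b10 x1 x2; clear; lra.
by rewrite in_itv /= => /andP[bb1 _] psib; exists b => //; exact: lt_le_trans bb1.
Qed.

Opaque partition_fun mean_energy mean_sq dual_sup.

Section tangent_minimizer.
Context {R : realType} (V : R -> \bar R).
Hypotheses (V_orlicz : orlicz V) (V_superquadratic : superquadratic V).
Hypothesis V_nontrivial : exists2 a : R, 0 < a & (V a < +oo)%E.
Local Notation Z := (partition_fun V).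

Lemma tangent_slope_le b p1 p2 : 0 < b ->
  (forall t, Z (- b) 0 * (1 + t * p1) <= Z (- b) t) ->
  (forall t, Z (- b) 0 * (1 + t * p2) <= Z (- b) t) -> p1 <= p2.
Proof.
move=> b0; have nb0 : - b < 0 by rewrite oppr_lt0.
apply: (slope_le (C := 4 * Z (- b) (0 + 2))); first exact: partition_gt0.
  by apply: mulr_gt0; [exact: ltr0Sn|exact: partition_gt0].
move=> l l0 l1.
have c01 : 0 <= (1 : R) <= 1 by rewrite ler01 lexx.
have t0 : (1 : R) * 0 <= 0 by rewrite mulr0.
have := partition_second_difference_sq V_orlicz V_superquadratic b0 (lexx _) c01 t0 l0 l1.
by rewrite !mul1r add0r sub0r.
Qed.

Lemma tangent_minimizer b q : 0 < b -> 0 <= q ->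
  (forall s t, s < 0 -> Z (- b) 0 * expR (s + b + t * q) <= Z s t) ->
  unique (fun z : nonneg_reals R => forall z', (rate_JXV V z <= rate_JXV V z')%E)
    (nonneg_sqrt q).
Proof.
move=> b0 q0 HT.
have nb0 : - b < 0 by rewrite oppr_lt0.
have zp : 0 < Z (- b) 0 by exact: partition_gt0.
have tangent s t : s < 0 -> s + t * q - ln (Z s t) <= - b - ln (Z (- b) 0).
  move=> s0; have := HT s t s0.
  have Zp : 0 < Z s t by exact: partition_gt0.
  rewrite (mul_expR_le_ln _ zp Zp); move: (ln _) (ln _) => x y; clear; lra.
have SE : fine (dual_sup V) = - b - ln (Z (- b) 0).
  apply/eqP; rewrite eq_le; apply/andP; split; last exact: dual_le.
  apply/ler_addgt0Pr => e e0.
  have [s s0 Hs] := dual_near V_orlicz V_superquadratic V_nontrivial e0.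
  have := tangent s 0 s0; rewrite mul0r; move: Hs.
  by move: (ln (Z s 0)) (ln _) (fine _) => x y S; clear; lra.
have J0 : (rate_JXV V (nonneg_sqrt q) <= 0)%E.
  rewrite leNgt; apply/negP.
  move=> /(rate_JXV_gt V_orlicz V_superquadratic V_nontrivial)[s [t [s0]]].
  rewrite add0r SE /= sqr_sqrtr // ltNge => /negP; apply; exact: tangent.
split=> [z'|z Hz].
  exact: le_trans J0 (rate_JXV_ge0 V_orlicz V_superquadratic V_nontrivial z').
have Jz := le_trans (Hz _) J0.
have T1 t : Z (- b) 0 * (1 + t * q) <= Z (- b) t.
  have := HT (- b) t nb0; rewrite addNr add0r; apply: le_trans.
  by rewrite ler_pM2l // expR_ge1Dx.
have T2 t : Z (- b) 0 * (1 + t * \val z ^+ 2) <= Z (- b) t.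
  have := le_trans (rate_JXV_ge V_orlicz V_superquadratic V_nontrivial z t nb0) Jz.
  rewrite lee_fin SE => H.
  have Ztp : 0 < Z (- b) t by exact: partition_gt0.
  apply: (@le_trans _ _ (Z (- b) 0 * expR (t * \val z ^+ 2))).
    by rewrite ler_pM2l // expR_ge1Dx.
  rewrite (mul_expR_le_ln _ zp Ztp); move: H.
  by move: (ln (Z (- b) t)) (ln _) => x y; clear; lra.
have zq : q = \val z ^+ 2.
  by apply/eqP; rewrite eq_le !(tangent_slope_le (b := b)).
by apply/val_inj; rewrite /= zq sqrtr_sqr ger0_norm // nonneg_val_ge0.
Qed.

End tangent_minimizer.

(** * Existence and uniqueness of the Gibbs parameter *)

Section gibbs_parameter.
Context {R : realType} (V : R -> \bar R).
Hypotheses (V_orlicz : orlicz V) (V_superquadratic : superquadratic V).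
Hypothesis V_nontrivial : exists2 a : R, 0 < a & (V a < +oo)%E.
Local Notation mu := (@lebesgue_measure R).
Local Notation Z := (partition_fun V).
Local Notation w b := (tilt V (- b) 0).
Local Notation A := (mean_energy V).

(** The factor e^b turns (V - 1) e^(- b V), which increases in b where 0 < V < 1, into (V - 1) e^(-
    b (V - 1)), which is pointwise nonincreasing in b. *)
Definition excess b x := expR b * (fine (V x) * w b x - w b x).

Lemma excess_dom b x : (V x < +oo)%E ->
  excess b x = - ((1 - fine (V x)) * expR (b * (1 - fine (V x)))).
Proof.
move=> Vx; rewrite /excess /tilt Vx mul0r addr0.
have -> : b * (1 - fine (V x)) = b + - b * fine (V x) by ring.
by rewrite expRD; ring.
Qed.

Lemma excess_out b x : (V x < +oo)%E = false -> excess b x = 0.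
Proof. by move=> Vx; rewrite /excess /tilt Vx mulr0 subrr mulr0. Qed.

Let iw b : 0 < b -> mu.-integrable setT (EFin \o w b).
Proof. by move=> b0; apply: integrable_tilt; rewrite // oppr_lt0. Qed.

Let integrable_diff b : 0 < b ->
  mu.-integrable setT (EFin \o (fun x => fine (V x) * w b x - w b x)).
Proof.
move=> b0; have iE := integrable_energy V_orlicz V_superquadratic b0.
have := integrableB measurableT iE (iw b0).
by apply: eq_integrable => // x _; rewrite /= EFinB.
Qed.

Let integrable_excess b : 0 < b -> mu.-integrable setT (EFin \o excess b).
Proof.
move=> b0; have := integrableZl measurableT (expR b) (integrable_diff b0).
by apply: eq_integrable => // x _; rewrite /= EFinM.
Qed.

Lemma Rintegral_excess b : 0 < b ->
  \int[mu]_x excess b x = expR b * (A b - Z (- b) 0).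
Proof.
move=> b0; have iE := integrable_energy V_orlicz V_superquadratic b0.
rewrite /excess (RintegralZl _ measurableT (integrable_diff b0)).
by rewrite (RintegralB measurableT iE (iw b0)) -partition_RE.
Qed.

(** Pointwise the excess never increases, and on an interval [0, a] where V <= 1/2 it drops by the
    amount of [mul_expR_gap]; integrating over that interval gives an unbounded decay. *)
Lemma gibbs_excess_decreasing : exists2 a, 0 < a & forall b b', 0 < b -> b <= b' ->
  \int[mu]_x excess b' x + a * (expR (b' / 2) - expR (b / 2))
    <= \int[mu]_x excess b x.
Proof.
have h2 : (0 : R) < 1 / 2 by rewrite divr_gt0.
have [a a0 Va] := orlicz_small_near0 V_orlicz V_nontrivial h2.
exists (a / 2) => [|b b' b0 bb']; first by rewrite divr_gt0.
have b'0 : 0 < b' := lt_le_trans b0 bb'.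
pose k := (expR (b' / 2) - expR (b / 2)) / 2.
pose I := `[0, a]%classic : set R.
have mI : measurable I by exact: measurable_itv.
have muI : mu I = a%:E by rewrite lebesgue_measure_itv /= lte_fin a0 -EFinB subr0.
have iI : mu.-integrable setT (EFin \o (\1_I : R -> R)).
  exact: integrable_indic_itv.
have -> : a / 2 * (expR (b' / 2) - expR (b / 2)) = \int[mu]_x (k * \1_I x).
  have E : (\int[mu]_x (\1_I x)%:E = a%:E)%E by rewrite -muI integral_indic // setIT.
  by rewrite (RintegralZl _ measurableT iI) /Rintegral E /k /=; ring.
have ikI : mu.-integrable setT (EFin \o (fun x => k * \1_I x)).
  by have := integrableZl measurableT k iI; apply: eq_integrable.
rewrite -(RintegralD measurableT (integrable_excess b'0) ikI).
apply: le_Rintegral => //.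
- have := integrableD measurableT (integrable_excess b'0) ikI.
  by apply: eq_integrable.
- exact: integrable_excess.
move=> x _; rewrite indicE; have [/set_mem|] := boolP (x \in I).
  rewrite /I /= in_itv /= => /andP[x0 xa].
  have := Va x; rewrite ger0_norm // => /(_ xa) Vx.
  have Voo : (V x < +oo)%E by rewrite (le_lt_trans Vx) // ltry.
  have v2 : fine (V x) <= 1 / 2 by rewrite -lee_fin orlicz_fin.
  rewrite !excess_dom //.
  have y2 : 1 / 2 <= 1 - fine (V x) by move: v2; move: (fine _) => v; lra.
  have := mul_expR_gap b0 bb' y2; rewrite mulr1 /k; move: (fine _) => v; lra.
move=> _; rewrite mulr0 addr0; case Vx : (V x < +oo)%E; last by rewrite !excess_out.
rewrite !excess_dom // lerN2; set y := 1 - _.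
have [y0|y0] := leP 0 y; first by rewrite ler_wpM2l // ler_expR ler_wpM2r.
by rewrite ler_wnM2l ?(ltW y0) // ler_expR ler_wnM2r // ltW.
Qed.

(** For u < b < v the factor e^b is at most e^v and the weight at most that of [u], which gives an
    integrable bound uniform in b. *)
Lemma gibbs_excess_continuous u v : 0 < u ->
  {in `]u, v[%classic, continuous (fun b => \int[mu]_x excess b x)}.
Proof.
move=> u0.
have Ipos l : l \in `]u, v[%classic -> 0 < l.
  by rewrite inE /= in_itv /= => /andP[ul _]; exact: lt_trans ul.
pose g x := expR v * (fine (V x) * w u x + w u x).
have ig : mu.-integrable setT (EFin \o g).
  have iE := integrable_energy V_orlicz V_superquadratic u0.
  have := integrableZl measurableT (expR v) (integrableD measurableT iE (iw u0)).
  by apply: eq_integrable => // x _; rewrite /= EFinM EFinD.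
apply: (@continuity_under_integral R _ _ mu excess setT measurableT u v _ _ g ig) => //.
- by move=> l Il; apply: integrable_excess; apply: Ipos; exact/mem_set.
- apply: aeW => x _ l _; case Vx : (V x < +oo)%E; last first.
    rewrite (_ : excess ^~ x = cst 0); first exact: cst_continuous.
    by apply/funext => y; rewrite excess_out.
  rewrite (_ : excess ^~ x = fun y => (fine (V x) - 1) * expR (y * (1 - fine (V x)))).
    apply: cvgM; first exact: cvg_cst.
    apply: continuous_comp; last exact: continuous_expR.
    by apply: cvgM => //; exact: cvg_cst.
  by apply/funext => y; rewrite excess_dom //; ring.
- move=> l; rewrite /= in_itv /= => /andP[ul lv]; apply: aeW => x _.
  have l0 := lt_trans u0 ul; have v0 := fine_orlicz_ge0 V_orlicz x.
  rewrite /g /excess normrM (ger0_norm (expR_ge0 _)).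
  apply: ler_pM => //; first by rewrite ler_expR ltW.
  apply: le_trans (ler_normB _ _) _.
  rewrite !ger0_norm ?mulr_ge0 ?tilt_ge0 //.
  have wle : w l x <= w u x.
    rewrite /tilt; case: ifP => // Vx; rewrite ler_expR lerD2r ler_wpM2r //.
    by rewrite lerN2 ltW.
  by rewrite lerD // ler_wpM2l.
Qed.

Let pos_part x : R := if (V x < +oo)%E then Num.max (fine (V x) - 1) 0 else 0.
Let neg_part x : R := if (V x < +oo)%E then Num.max (1 - fine (V x)) 0 else 0.

Let measurable_finite : measurable_fun setT (fun x => (V x < +oo)%E).
Proof.
by apply: (measurable_fun_bool true); rewrite setTI; exact: measurable_orlicz_dom.
Qed.

Let measurable_pos_part : measurable_fun setT pos_part.
Proof.
apply: measurable_fun_ifT => //; apply: measurable_maxr => //.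
by apply: measurable_funB => //; exact: measurable_fine_orlicz.
Qed.

Let measurable_neg_part : measurable_fun setT neg_part.
Proof.
apply: measurable_fun_ifT => //; apply: measurable_maxr => //.
by apply: measurable_funB => //; exact: measurable_fine_orlicz.
Qed.

Let pos_part_ge0 x : 0 <= pos_part x.
Proof. by rewrite /pos_part; case: ifP => // _; rewrite le_max lexx orbT. Qed.

Let neg_part_ge0 x : 0 <= neg_part x.
Proof. by rewrite /neg_part; case: ifP => // _; rewrite le_max lexx orbT. Qed.

Lemma mean_exceeds_one_parts : mean_exceeds_one V ->
  (\int[mu]_x (neg_part x)%:E < \int[mu]_x (pos_part x)%:E)%E.
Proof.
pose f x := (V x - 1)%E.
have domE x : (x \in orlicz_dom V) = (V x < +oo)%E.
  by apply/idP/idP => [/set_mem //|?]; exact/mem_set.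
have fE x : (V x < +oo)%E -> f x = (fine (V x) - 1)%:E.
  by move=> Vx; rewrite /f EFinB orlicz_fin.
have PE : (\int[mu]_(x in orlicz_dom V) f^\+ x = \int[mu]_x (pos_part x)%:E)%E.
  rewrite integral_mkcond; apply: eq_integral => x _.
  rewrite patchE domE /pos_part; case: ifP => // Vx.
  by rewrite funeposE fE // EFin_max.
have NE : (\int[mu]_(x in orlicz_dom V) f^\- x = \int[mu]_x (neg_part x)%:E)%E.
  rewrite integral_mkcond; apply: eq_integral => x _.
  rewrite patchE domE /neg_part; case: ifP => // Vx.
  by rewrite funenegE fE // EFin_max -EFinN opprB.
by rewrite /mean_exceeds_one integralE sube_gt0 -/f PE NE.
Qed.

(** The hypothesis says that the weighted positive part of V - 1 integrates to at most the weighted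
    negative part, whose weight is then bounded by 1. The weight stays on the positive part, where
    it increases as b decreases. Adding the finite Z(- b, 0) to both sides avoids a subtraction. *)
Lemma weighted_pos_part_le b : 0 < b -> A b <= Z (- b) 0 ->
  (\int[mu]_x (pos_part x * w b x)%:E <= \int[mu]_x (neg_part x)%:E)%E.
Proof.
move=> b0 AZ.
have nb0 : - b < 0 by rewrite oppr_lt0.
have mw : measurable_fun setT (w b) by exact: measurable_tilt.
have w0 x : 0 <= w b x by exact: tilt_ge0.
have mv : measurable_fun setT (fun x => fine (V x)) by exact: measurable_fine_orlicz.
have v0 x : 0 <= fine (V x) by exact: fine_orlicz_ge0.
have mE (f : R -> R) : measurable_fun setT f -> measurable_fun setT (fun x => (f x)%:E).
  by move=> mf; apply: measurableT_comp.
have AE : ((A b)%:E = \int[mu]_x (fine (V x) * w b x)%:E)%E.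
  by rewrite fineK //; exact: integrable_fin_num (integrable_energy V_orlicz V_superquadratic b0).
have intD (f g : R -> R) : measurable_fun setT f -> measurable_fun setT g ->
    (forall x, 0 <= f x) -> (forall x, 0 <= g x) ->
    (\int[mu]_x (f x)%:E + \int[mu]_x (g x)%:E = \int[mu]_x (f x + g x)%:E)%E.
  move=> mf mg f0 g0; rewrite -ge0_integralD //; try exact: mE.
    by move=> x _; rewrite lee_fin.
  by move=> x _; rewrite lee_fin.
have : (\int[mu]_x (pos_part x * w b x)%:E + \int[mu]_x (w b x)%:E <=
        \int[mu]_x (fine (V x) * w b x)%:E + \int[mu]_x (neg_part x)%:E)%E.
  have mp : measurable_fun setT (fun x => pos_part x * w b x) by exact: measurable_funM.
  have me : measurable_fun setT (fun x => fine (V x) * w b x) by exact: measurable_funM.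
  have p0 x : 0 <= pos_part x * w b x by rewrite mulr_ge0.
  have e0 x : 0 <= fine (V x) * w b x by rewrite mulr_ge0.
  rewrite !intD //; apply: ge0_le_integral => //.
  - by move=> x _; rewrite lee_fin addr_ge0.
  - by apply: mE; exact: measurable_funD.
  - by apply: mE; exact: measurable_funD.
  move=> x _; rewrite lee_fin /pos_part /neg_part /tilt.
  case: ifP => Vx; last by rewrite !mulr0 addr0.
  rewrite mul0r addr0.
  have : expR (- b * fine (V x)) <= 1.
    by rewrite -[leRHS]expR0 ler_expR mulNr oppr_le0 mulr_ge0 // ltW.
  have := expR_ge0 (- b * fine (V x)).
  move: (expR _) => e; move: (fine _) => v e_ge0 e_le1.
  have [v1|v1] := lerP 1 v.
    by rewrite max_l ?subr_ge0 // max_r ?subr_le0 //; lra.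
  have v1' := ltW v1.
  have : (1 - v) * e <= (1 - v) * 1 by rewrite ler_wpM2l // subr_ge0.
  by rewrite max_r ?subr_le0 // max_l ?subr_ge0 //; lra.
rewrite -AE partitionE // => H.
rewrite -(@leeD2rE _ (Z (- b) 0)%:E) //; apply: le_trans H _.
by rewrite addeC leeD2l // lee_fin.
Qed.

(** Otherwise [weighted_pos_part_le] holds for all b > 0, and monotone convergence along b = 1 / (n
    + 1) contradicts [mean_exceeds_one]. The integral of the positive part may be infinite. *)
Lemma gibbs_excess_pos : mean_exceeds_one V -> exists2 b, 0 < b & Z (- b) 0 < A b.
Proof.
move=> /mean_exceeds_one_parts PN; apply: contrapT => H; move: PN; apply/negP; rewrite -leNgt.
have Hb b : 0 < b -> A b <= Z (- b) 0.
  by move=> b0; rewrite leNgt; apply/negP => AZ; apply: H; exists b.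
pose g n x := (pos_part x * w n.+1%:R^-1 x)%:E.
have n0 n : 0 < n.+1%:R^-1 :> R by rewrite invr_gt0.
have cg x : g n x @[n --> \oo] --> (pos_part x)%:E.
  apply: cvg_EFin; first exact: nearW.
  rewrite /comp /= /pos_part /tilt; case: ifP => Vx; last first.
    by under eq_fun do rewrite mul0r; exact: cvg_cst.
  rewrite -[X in _ --> X]mulr1; apply: cvgM; first exact: cvg_cst.
  rewrite -[X in _ --> X](@expR0 R); apply: continuous_cvg; first exact: continuous_expR.
  have e0 : - 0 * fine (V x) + 0 * x ^+ 2 = 0 by rewrite oppr0 !mul0r addr0.
  rewrite -[X in _ --> X]e0.
  apply: cvgD; last exact: cvg_cst.
  apply: cvgM; last exact: cvg_cst.
  by apply: cvgN; exact: cvg_harmonic.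
have mg n : measurable_fun setT (g n).
  apply: measurableT_comp => //; apply: measurable_funM => //; exact: measurable_tilt.
have g0 n x : (0 <= g n x)%E by rewrite lee_fin mulr_ge0 // tilt_ge0.
have ndg x : {homo g ^~ x : n m / (n <= m)%N >-> (n <= m)%E}.
  move=> n m nm; rewrite lee_fin ler_wpM2l //.
  rewrite /tilt; case: ifP => // Vx; rewrite ler_expR lerD2r.
  apply: ler_wpM2r; first exact: fine_orlicz_ge0.
  by rewrite lerN2 lef_pV2 ?posrE // ler_nat.
have := @cvg_monotone_convergence _ _ _ mu setT measurableT g mg
  (fun n x _ => g0 n x) (fun x _ => ndg x).
have -> : (\int[mu]_x limn (g ^~ x) = \int[mu]_x (pos_part x)%:E)%E.
  by apply: eq_integral => x _; exact/cvg_lim.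
move=> cint; rewrite -(cvg_lim _ cint) //; apply: lime_le.
  by apply/cvg_ex; eexists; exact: cint.
by apply: nearW => n; apply: weighted_pos_part_le; rewrite // Hb.
Qed.

Lemma exists_gibbs_parameter : mean_exceeds_one V -> exists2 b, 0 < b & A b = Z (- b) 0.
Proof.
move=> V1; have [a a0 Hd] := gibbs_excess_decreasing.
have [b1 b10 pos1] := gibbs_excess_pos V1.
have [|b b0] := exists_zero_of_decay a0 b10 _ Hd gibbs_excess_continuous.
  by rewrite Rintegral_excess //; apply: mulr_gt0; [exact: expR_gt0|rewrite subr_gt0].
rewrite Rintegral_excess // => /eqP psib; exists b => //.
by apply/eqP; rewrite -subr_eq0; move: psib; rewrite mulf_eq0 gt_eqF // expR_gt0.
Qed.

Lemma gibbs_parameter_inj b b' : 0 < b -> 0 < b' ->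
  A b = Z (- b) 0 -> A b' = Z (- b') 0 -> b = b'.
Proof.
have [a a0 Hd] := gibbs_excess_decreasing.
move=> b0 b'0 Ab Ab'; apply/eqP; rewrite eq_le; apply/andP.
suff H c c' : 0 < c -> A c = Z (- c) 0 -> A c' = Z (- c') 0 -> c' <= c.
  by split; exact: H.
move=> c0 Ac Ac'; rewrite leNgt; apply/negP => cc'.
have c'0 := lt_trans c0 cc'.
have := Hd c c' c0 (ltW cc'); rewrite !Rintegral_excess // Ac Ac' !subrr !mulr0 add0r.
apply/negP; rewrite -ltNge mulr_gt0 // subr_gt0 ltr_expR.
by rewrite ltr_pM2r // invr_gt0.
Qed.

Lemma gibbs_minimizer b : 0 < b -> A b = Z (- b) 0 ->
  unique (fun z : nonneg_reals R => forall z', (rate_JXV V z <= rate_JXV V z')%E)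
    (nonneg_sqrt (mean_sq V b / Z (- b) 0)).
Proof.
move=> b0 Ab; apply: (tangent_minimizer V_orlicz V_superquadratic V_nontrivial b0); last first.
  by move=> s t s0; exact: partition_tangent.
have zp : 0 < Z (- b) 0 by apply: partition_gt0 => //; rewrite oppr_lt0.
apply: divr_ge0; last exact: ltW.
apply: Rintegral_ge0 => x _; apply: mulr_ge0; [exact: sqr_ge0|exact: tilt_ge0].
Qed.

End gibbs_parameter.

Local Open Scope ereal_scope.

Theorem proposition3p11 (R : realType) (V : R -> \bar R)
  (V_orlicz : orlicz V) (V_superquadratic : superquadratic V)
  (d : nat -> measure_display) (Omega : forall n, measurableType (d n))
  (P : forall n, probability (Omega n) R)
  (X : forall n, {mfun Omega n >-> n.-tuple R})
  (X_uniform : forall n, (0 < n)%N ->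
     uniform_on (P n) (orlicz_ball V n) (X n)) :
  [/\ good_rate_function (rate_JXV V),
      ldp P (fun n omega => scaled_norm (X n omega)) (fun n => n%:R%R)
        (rate_JXV V) &
      mean_exceeds_one V ->
      exists b : R,
        unique (fun b' : R => (0 < b')%R /\ moment_V V (gibbs V b') = 1) b /\
        unique (fun z : nonneg_reals R => forall z', rate_JXV V z <= rate_JXV V z')
          (nonneg_sqrt (fine (moment_2 (gibbs V b))))].
Proof.
have Vn := uniform_nontrivial V_orlicz (X_uniform 1%N (ltn0Sn 0)).
split; [exact: rate_JXV_good|exact: ldp_JXV|move=> V1].
have [b b0 meanb] := exists_gibbs_parameter V_orlicz V_superquadratic Vn V1.
have Zp c : (0 < c)%R -> (0 < partition_fun V (- c) 0)%R.
  by move=> c0; apply: partition_gt0 => //; rewrite oppr_lt0.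
exists b; split; last first.
  by rewrite moment_2E //=; exact: gibbs_minimizer.
split.
  by split=> //; rewrite moment_VE // meanb divff // gt_eqF // Zp.
move=> b' [b'0]; rewrite moment_VE // => -[meanb'].
have {}meanb' : mean_energy V b' = partition_fun V (- b') 0.
  by rewrite -[RHS]mul1r -meanb' divfK // gt_eqF // Zp.
by apply: (gibbs_parameter_inj V_orlicz V_superquadratic Vn).
Qed.
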